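(* Let $M=\mathbb{S}(\mathcal{S}^3)$ with the Bryant--Salamon torsion-free $\mathrm{G}_2$-structure $\varphi_c$ ($c>0$) and let $M_0=M\setminus\mathcal{S}^3$ with the conical $\mathrm{G}_2$-structure $\varphi_0$. Let $g_{\mathcal{S}^3}$ denote the constant curvature $1$ metric on $\mathcal{S}^3$. (a) On $M$, the induced metric on the coassociative $\mathbb{R}^4$ fibres of the projection $M\to\mathcal{S}^3$ is conformally flat and asymptotically conical with rate $-3$ to the metric $$g_{\mathbb{R}^+\times\mathcal{S}^3}=dR^2+\tfrac49R^2g_{\mathcal{S}^3},$$ where $R$ is the coordinate on $\mathbb{R}^+$. (b) On $M_0$, the induced metric on the coassociative $\mathbb{R}^4\setminus\{0\}$ fibres of $M_0\to\mathcal{S}^3$ is precisely the cone metric $g_{\mathbb{R}^+\times\mathcal{S}^3}$, which is conformally flat, but not flat, and so is not smooth at the origin. Moreover, in both $M$ and $M_0$, the induced hypersymplectic triple on the coassociative fibres is (up to a constant multiple) the standard hyperk\''ahler triple $(\omega_1,\omega_2,\omega_3)$ on $\mathbb{R}^4$ given by $$\omega_1=dy_0\wedge dy_1-dy_2\wedge dy_3,\quad\omega_2=dy_0\wedge dy_2-dy_3\wedge dy_1,\quad\omega_3=dy_0\wedge dy_3-dy_1\wedge dy_2,$$ where $(y_0,y_1,y_2,y_3)$ are the linear fibre coordinates.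
   Context: Let $\sigma_1,\sigma_2,\sigma_3$ be the standard left-invariant coframe on $\mathcal{S}^3\cong\mathrm{SU}(2)$ with $d\sigma_1=\sigma_2\wedge\sigma_3$, $d\sigma_2=\sigma_3\wedge\sigma_1$, $d\sigma_3=\sigma_1\wedge\sigma_2$. Put $b_j=\frac12\sigma_j$ (orthonormal for the curvature $1$ metric), $\rho_j=-\frac14\sigma_j$, $\mathrm{vol}_{\mathcal{S}^3}=b_1\wedge b_2\wedge b_3$. The bundle $M=\mathbb{S}(\mathcal{S}^3)\cong\mathbb{R}^4\times\mathcal{S}^3$ has linear fibre coordinates $(a_0,a_1,a_2,a_3)$ (denoted $y_k=a_k$ in the claim), $r^2=\sum a_i^2$, and $\mathcal{S}^3\subset M$ is the zero section. Set $\zeta_0=da_0+a_1\rho_1+a_2\rho_2+a_3\rho_3$, $\zeta_1=da_1-a_0\rho_1+a_3\rho_2-a_2\rho_3$, $\zeta_2=da_2-a_3\rho_1-a_0\rho_2+a_1\rho_3$, $\zeta_3=da_3+a_2\rho_1-a_1\rho_2-a_0\rho_3$, $\Omega_1=\zeta_0\wedge\zeta_1-\zeta_2\wedge\zeta_3$, $\Omega_2=\zeta_0\wedge\zeta_2-\zeta_3\wedge\zeta_1$, $\Omega_3=\zeta_0\wedge\zeta_3-\zeta_1\wedge\zeta_2$. For $c\ge0$, $$\varphi_c=3\sqrt3(c+r^2)\,\mathrm{vol}_{\mathcal{S}^3}+4\sqrt3\,(b_1\wedge\Omega_1+b_2\wedge\Omega_2+b_3\wedge\Omega_3),$$ $$g_c=3(c+r^2)^{2/3}(b_1^2+b_2^2+b_3^2)+4(c+r^2)^{-1/3}(\zeta_0^2+\zeta_1^2+\zeta_2^2+\zeta_3^2),$$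 where $g_c$ is the metric induced by $\varphi_c$ (on $M$ for $c>0$, on $M_0$ for $c=0$). A submanifold $N^4$ is coassociative if (up to orientation) $\varphi_c|_N\equiv0$. Asymptotically conical: a Riemannian manifold $(N,g)$ is asymptotically conical with rate $\lambda<0$ to the cone $(\mathbb{R}^+\times\Sigma,g_0=dR^2+R^2g_\Sigma)$ if there is a diffeomorphism $\Psi:(R_0,\infty)\times\Sigma\to N\setminus K$, $K$ compact, with $|\nabla^j(\Psi^*g-g_0)|=O(R^{\lambda-j})$ as $R\to\infty$ for all $j\in\mathbb{N}$. Hypersymplectic triple: a triple $(\omega_1,\omega_2,\omega_3)$ of closed 2-forms on an orientable 4-manifold with $\omega_i\wedge\omega_j=2Q_{ij}\nu$, $\nu$ a volume form and $(Q_{ij})$ a positive definite symmetric matrix of functions; hyperk\''ahler if $\nu$ can be chosen with $Q_{ij}=\delta_{ij}$ up to constant rotations and scalings. The induced triple on a coassociative fibre $N$ is $\omega_k=(n_k\lrcorner\varphi_c)|_N$, where $n_1,n_2,n_3$ are the normal vector fields dual to $b_1,b_2,b_3$. *)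

(* Defs.v *)
From HB Require Import structures.
From mathcomp Require Import all_boot all_order all_algebra all_fingroup.
From mathcomp Require Import all_classical all_reals all_analysis.
From mathcomp Require Import ring.
Import Order.TTheory GRing.Theory Num.Theory.
Import numFieldNormedType.Exports.

Set Implicit Arguments.
Unset Strict Implicit.
Unset Printing Implicit Defensive.

Local Open Scope classical_set_scope.
Local Open Scope ring_scope.

(** * Euclidean space

   [enorm] is needed because the library norm on row vectors is the sup norm
   (the two induce the same topology). *)

Section Euclidean.
Context {R : realType}.

Definition dot n (u v : 'rV[R]_n) : R := \sum_i u 0 i * v 0 i.
Definition enorm n (u : 'rV[R]_n) : R := Num.sqrt (dot u u).
Definition basis n (i : 'I_n) : 'rV[R]_n := delta_mx 0 i.

(* A map is C^oo on the open set U when all its iterated directional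
   derivatives are (Frechet) differentiable on U. *)
Definition iter_derive (V W : normedModType R) (s : seq V) (f : V -> W) : V -> W :=
  foldr (fun v h => fun x => 'D_v h x) f s.
Definition smooth_on (V W : normedModType R) (U : set V) (f : V -> W) : Prop :=
  forall (s : seq V) (x : V), U x -> differentiable (iter_derive s f) x.

(* f is a diffeomorphism from the open set U onto the open set U', with
   inverse f'. *)
Definition diffeo n (U U' : set 'rV[R]_n) (f f' : 'rV[R]_n -> 'rV[R]_n) : Prop :=
  [/\ (forall x, U x -> U' (f x) /\ f' (f x) = x),
      (forall y, U' y -> U (f' y) /\ f (f' y) = y),
      smooth_on U f & smooth_on U' f'].

End Euclidean.

(** * Exterior forms *)

Section Forms.
Context {R : realType}.

Definition form (V : Type) (k : nat) := ('I_k -> V) -> R.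

Definition covector (V : Type) (a : V -> R) : form V 1 := fun v => a (v ord0).

Definition vec2 (V : Type) (u w : V) : 'I_2 -> V :=
  fun i => if i == ord0 then u else w.

(* Normalised so that (a /\ b)(u, w) = a(u) b(w) - a(w) b(u) on covectors. *)
Definition wedge (V : Type) (k l : nat) (a : form V k) (b : form V l) :
    form V (k + l) :=
  fun v => (k`!%:R * l`!%:R)^-1 *
    \sum_(s : 'S_(k + l)) (-1) ^+ (odd_perm s) *
      a (fun i => v (s (lshift l i))) * b (fun j => v (s (rshift k j))).

(* Interior product: n is inserted in the first slot. *)
Definition contract (V : Type) (k : nat) (n : V) (a : form V k.+1) : form V k :=
  fun v => a (fun i => if unlift ord0 i is Some j then v j else n).

Definition multilinear_form (V : lmodType R) (k : nat) (a : form V k) : Prop :=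
  forall (v : 'I_k -> V) (i : 'I_k) (s : R) (u w : V),
    let upd z := fun j => if j == i then z else v j in
    a (upd (s *: u + w)) = s * a (upd u) + a (upd w).

Definition alternating_form (V : Type) (k : nat) (a : form V k) : Prop :=
  forall (v : 'I_k -> V) (i j : 'I_k), i != j -> v i = v j -> a v = 0.

Definition smooth_form (V : normedModType R) (k : nat) (U : set V)
    (w : V -> form V k) : Prop :=
  [/\ (forall x, U x -> multilinear_form (w x)),
      (forall x, U x -> alternating_form (w x)) &
      (forall v, smooth_on U (fun x => w x v : R^o))].

(* Exterior derivative on an open set of a vector space, evaluated on constant
   vector fields (whose brackets vanish). *)
Definition ext_derive (V : normedModType R) (k : nat) (w : V -> form V k) :
    V -> form V k.+1 :=
  fun x v => \sum_(i < k.+1) (-1) ^+ (i : nat) *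
    'D_(v i) (fun y => w y (fun j => v (lift i j)) : R^o) x.

Definition pullback_form (V W : normedModType R) (k : nat) (f : V -> W)
    (w : W -> form W k) : V -> form V k :=
  fun x v => w (f x) (fun i => 'D_(v i) f x).

End Forms.

(** * Riemannian metrics on open subsets of R^n *)

Section Metrics.
Context {R : realType}.

Definition pullback_metric (V W : normedModType R) (f : V -> W)
    (g : W -> W -> W -> R) : V -> V -> V -> R :=
  fun x u v => g (f x) ('D_u f x) ('D_v f x).

Definition metric n := 'rV[R]_n -> 'rV[R]_n -> 'rV[R]_n -> R.

Definition riemannian n (U : set 'rV[R]_n) (g : metric n) : Prop :=
  [/\ (forall x u v, U x -> g x u v = g x v u),
      (forall x s u v w, U x -> g x (s *: u + v) w = s * g x u w + g x v w),
      (forall x u, U x -> u != 0 -> 0 < g x u u) &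
      (forall u v, smooth_on U (fun x => g x u v : R^o))].

(* g on U and h on U' are isometric. *)
Definition isometric n (U : set 'rV[R]_n) (g : metric n)
    (U' : set 'rV[R]_n) (h : metric n) : Prop :=
  exists f f', diffeo U U' f f' /\
    forall x u v, U x -> pullback_metric f h x u v = g x u v.

Definition gram n (g : metric n) (x : 'rV[R]_n) : 'M[R]_n :=
  \matrix_(i, j) g x (basis i) (basis j).
Definition cogram n (g : metric n) (x : 'rV[R]_n) : 'M[R]_n := invmx (gram g x).

Definition partial n (i : 'I_n) (f : 'rV[R]_n -> R) (x : 'rV[R]_n) : R :=
  'D_(basis i) (f : 'rV[R]_n -> R^o) x.

(* [christoffel g x l i j] is the Levi-Civita symbol with upper index l and
   lower indices i, j. *)
Definition christoffel n (g : metric n) (x : 'rV[R]_n) (l i j : 'I_n) : R :=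
  2^-1 * \sum_m cogram g x l m *
    (partial i (fun y => gram g y j m) x + partial j (fun y => gram g y i m) x
     - partial m (fun y => gram g y i j) x).

(* The component along the l-th coordinate field of R(d_i, d_j) d_k. *)
Definition riemann n (g : metric n) (x : 'rV[R]_n) (l k i j : 'I_n) : R :=
  partial i (fun y => christoffel g y l j k) x
  - partial j (fun y => christoffel g y l i k) x
  + \sum_m (christoffel g x l i m * christoffel g x m j k
            - christoffel g x l j m * christoffel g x m i k).

Definition flat n (U : set 'rV[R]_n) (g : metric n) : Prop :=
  forall x, U x -> forall l k i j, riemann g x l k i j = 0.

Definition conformally_flat n (U : set 'rV[R]_n) (g : metric n) : Prop :=
  forall x, U x -> exists (V : set 'rV[R]_n) (f : 'rV[R]_n -> R),
    [/\ open V, V x & V `<=` U] /\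
    [/\ smooth_on V (f : 'rV[R]_n -> R^o), (forall y, V y -> 0 < f y) &
        flat V (fun y u v => f y * g y u v)].

(* The metric g, given on a punctured neighbourhood of the origin, is smooth at
   the origin: in some chart Phi around the origin (a homeomorphism which is a
   diffeomorphism away from the origin) it extends to a smooth Riemannian
   metric h.  Phi = id is the case of the given linear coordinates; allowing
   other charts makes the notion depend on g only up to isometry, so its
   negation is the intrinsic one. *)
Definition smooth_at_origin n (g : metric n) : Prop :=
  exists (V W : set 'rV[R]_n) (Phi Phi' : 'rV[R]_n -> 'rV[R]_n) (h : metric n),
    [/\ open V, V 0, open W & W 0] /\
    [/\ diffeo (V `\ 0) (W `\ 0) Phi Phi',
        Phi 0 = 0, {for 0, continuous Phi}, Phi' 0 = 0 &
        {for 0, continuous Phi'}] /\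
    riemannian W h /\
    forall x u v, V x -> x != 0 -> pullback_metric Phi h x u v = g x u v.

(** ** Covariant derivatives of tensors, in components *)

Definition tensor n k := 'rV[R]_n -> k.-tuple 'I_n -> R.

(* [cov_derive g T] is the covariant derivative of T, the direction of
   differentiation being the first index. *)
Definition cov_derive n k (g : metric n) (T : tensor n k) : tensor n k.+1 :=
  fun x t =>
    let i := thead t in
    let s : k.-tuple 'I_n := [tuple of behead t] in
    partial i (fun y => T y s) x
    - \sum_(m < k) \sum_(l < n) christoffel g x l i (tnth s m) *
        T x [tuple (if q == m then l else tnth s q) | q < k].

Fixpoint iter_cov_derive n k (g : metric n) (T : tensor n k) (j : nat) :
    tensor n (j + k) :=
  match j return tensor n (j + k) with
  | 0 => T
  | j'.+1 => cov_derive g (@iter_cov_derive n k g T j')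
  end.

Definition tensor_norm n k (g : metric n) (T : tensor n k) (x : 'rV[R]_n) : R :=
  Num.sqrt (\sum_(s : k.-tuple 'I_n) \sum_(t : k.-tuple 'I_n)
    (\prod_(m < k) cogram g x (tnth s m) (tnth t m)) * T x s * T x t).

Definition metric_tensor n (g : metric n) : tensor n 2 :=
  fun x t => g x (basis (tnth t 0)) (basis (tnth t 1)).

(** ** Cones over spheres

   [cone_metric gS] is dR^2 + R^2 gS at the point (R, theta) of the cone over
   the unit sphere.  The cone (R0, oo) x S^(n-1) is identified with the open set
   of all x with R0 < |x| by polar coordinates x |-> (|x|, x / |x|), so that
   tensors on it have components and R becomes the Euclidean norm. *)

Definition cone_metric n (gS : metric n) :
    (R^o * 'rV[R]_n) -> (R^o * 'rV[R]_n) -> (R^o * 'rV[R]_n) -> R :=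
  fun z u v => u.1 * v.1 + z.1 ^+ 2 * gS z.2 u.2 v.2.

Definition polar n (x : 'rV[R]_n) : R^o * 'rV[R]_n :=
  (enorm x, (enorm x)^-1 *: x).

Definition cone n (R0 : R) : set 'rV[R]_n := [set x | R0 < enorm x].

Definition cone_chart_metric n (gS : metric n) : metric n :=
  pullback_metric (@polar n) (cone_metric gS).

(* The constant curvature 1 metric on the unit sphere. *)
Definition round_metric n : metric n := fun _ u v => dot u v.

(* (N, g), N open in R^n, is asymptotically conical with rate lambda to the
   cone over (S^(n-1), gS). *)
Definition asymptotically_conical n (N : set 'rV[R]_n) (g : metric n)
    (lambda : R) (gS : metric n) : Prop :=
  lambda < 0 /\ riemannian N g /\
  exists (R0 : R) (K : set 'rV[R]_n) (Psi Psi' : 'rV[R]_n -> 'rV[R]_n),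
    [/\ 0 <= R0, compact K, K `<=` N & diffeo (@cone n R0) (N `\` K) Psi Psi'] /\
    let g0 := cone_chart_metric gS in
    let T : tensor n 2 := metric_tensor
      (fun x u v => pullback_metric Psi g x u v - g0 x u v) in
    forall j : nat, exists C R1 : R, forall x, R0 < enorm x -> R1 < enorm x ->
      tensor_norm g0 (@iter_cov_derive n 2 g0 T j) x <= C * enorm x `^ (lambda - j%:R).

End Metrics.

(** * Hypersymplectic triples on open subsets of R^4 *)

Section Hypersymplectic.
Context {R : realType}.
Local Notation R4 := 'rV[R]_4.

Definition triple := 'I_3 -> R4 -> @form R R4 2.

Definition volume_form (U : set R4) (nu : R4 -> @form R R4 4) : Prop :=
  smooth_form U nu /\ forall x, U x -> nu x (@basis R 4) != 0.

Definition closed_triple (U : set R4) (w : triple) : Prop :=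
  forall i, smooth_form U (w i) /\
    forall x v, U x -> ext_derive (w i) x v = 0.

Definition gram_of_triple (U : set R4) (w : triple)
    (nu : R4 -> @form R R4 4) (Q : R4 -> 'M[R]_3) : Prop :=
  forall x i j v, U x -> wedge (w i x) (w j x) v = 2 * Q x i j * nu x v.

Definition hypersymplectic (U : set R4) (w : triple) : Prop :=
  closed_triple U w /\
  exists nu Q, [/\ volume_form U nu, gram_of_triple U w nu Q,
    (forall x, U x -> (Q x)^T = Q x) &
    (forall x (u : 'rV[R]_3), U x -> u != 0 -> 0 < (u *m Q x *m u^T) 0 0)].

(* A constant rotation A followed by scalings s_i brings the triple to one
   whose matrix is the identity. *)
Definition hyperkahler (U : set R4) (w : triple) : Prop :=
  hypersymplectic U w /\
  exists (nu : R4 -> @form R R4 4) (A : 'M[R]_3) (s : 'I_3 -> R),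
    [/\ volume_form U nu, A *m A^T = 1%:M, \det A = 1, (forall i, 0 < s i) &
        gram_of_triple U (fun i x v => s i * \sum_j A i j * w j x v) nu
          (fun _ => 1%:M)].

(* The triple e0 /\ ej - ek /\ el, (j, k, l) a cyclic permutation of (1, 2, 3);
   the index j : 'I_3 stands for j + 1 and is added modulo 3. *)
Definition asd_triple (V : Type) (e : 'I_4 -> V -> R) (j : 'I_3) : @form R V 2 :=
  let e' (i : 'I_3) := covector (e (lift ord0 i)) in
  fun v => wedge (covector (e ord0)) (e' j) v - wedge (e' (j + 1)) (e' (j + 2)) v.

Definition standard_triple : triple := fun j _ => asd_triple (fun k (u : R4) => u 0 k) j.

End Hypersymplectic.

(** * The Bryant--Salamon structure on the spinor bundle of S^3 *)

Section BryantSalamon.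
Context {R : realType}.
Local Notation R4 := 'rV[R]_4.

(* A point of R^4 x S^3 is a pair (a, p) with |p| = 1; a tangent vector there
   is a pair (u, v) with v orthogonal to p.  The factor S^3 = SU(2) is the group
   of unit quaternions p = p0 + p1 i + p2 j + p3 k. *)
Local Notation E := (R4 * R4)%type.

Definition sphere : set R4 := [set p | dot p p = 1].

Definition row4 (x0 x1 x2 x3 : R) : R4 := \row_i tnth [tuple x0; x1; x2; x3] i.

Definition qmul (p q : R4) : R4 :=
  row4 (p 0 0 * q 0 0 - p 0 1 * q 0 1 - p 0 2 * q 0 2 - p 0 3 * q 0 3)
       (p 0 0 * q 0 1 + p 0 1 * q 0 0 + p 0 2 * q 0 3 - p 0 3 * q 0 2)
       (p 0 0 * q 0 2 - p 0 1 * q 0 3 + p 0 2 * q 0 0 + p 0 3 * q 0 1)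
       (p 0 0 * q 0 3 + p 0 1 * q 0 2 - p 0 2 * q 0 1 + p 0 3 * q 0 0).

(* The left-invariant coframe; j : 'I_3 stands for j + 1.  The form
   v |-> <p e_j, v> is the e_j-component theta_j of the Maurer--Cartan form
   p^-1 dp, and d theta_1 = - 2 theta_2 /\ theta_3; hence the factor -2. *)
Definition sigma (j : 'I_3) (p v : R4) : R :=
  - 2 * dot (qmul p (basis (lift ord0 j))) v.

(* The forms on the total space, at the point m = (a, p). *)
Definition b_ (j : 'I_3) (m : E) (t : E) : R := 2^-1 * sigma j m.2 t.2.
Definition rho (j : 'I_3) (m : E) (t : E) : R := - 4^-1 * sigma j m.2 t.2.

Definition zeta (k : 'I_4) (m : E) (t : E) : R :=
  let a := m.1 in let da := t.1 in
  let r1 := rho 0 m t in let r2 := rho 1 m t in let r3 := rho 2 m t in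
  tnth [tuple
    da 0 0 + a 0 1 * r1 + a 0 2 * r2 + a 0 3 * r3;
    da 0 1 - a 0 0 * r1 + a 0 3 * r2 - a 0 2 * r3;
    da 0 2 - a 0 3 * r1 - a 0 0 * r2 + a 0 1 * r3;
    da 0 3 + a 0 2 * r1 - a 0 1 * r2 - a 0 0 * r3] k.

Definition vol_S3 (m : E) : @form R E 3 :=
  wedge (covector (b_ 0 m)) (wedge (covector (b_ 1 m)) (covector (b_ 2 m))).

Definition Omega (j : 'I_3) (m : E) : @form R E 2 := asd_triple (fun k => zeta k m) j.

Definition phi (c : R) (m : E) : @form R E 3 := fun v =>
  3 * Num.sqrt 3 * (c + dot m.1 m.1) * vol_S3 m v
  + 4 * Num.sqrt 3 * \sum_(j < 3) wedge (covector (b_ j m)) (Omega j m) v.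

Definition g_BS (c : R) (m s t : E) : R :=
  3 * (c + dot m.1 m.1) `^ (2 / 3) * (\sum_(j < 3) b_ j m s * b_ j m t)
  + 4 * (c + dot m.1 m.1) `^ (- 3^-1) * (\sum_(k < 4) zeta k m s * zeta k m t).

(* The fibre over p of M -> S^3 (c > 0) or of M_0 -> S^3 (c = 0) is the domain
   [fibre c], embedded in the total space by [fibre_map p]. *)
Definition fibre (c : R) : set R4 := if c == 0 then ~` [set 0] else setT.

Definition fibre_map (p : R4) (a : R4) : E := (a, p).

Definition coassociative (c : R) (U : set R4) (f : R4 -> E) : Prop :=
  forall x v, U x -> pullback_form f (phi c) x v = 0.

Definition fibre_metric (c : R) (p : R4) : @metric R 4 :=
  pullback_metric (fibre_map p) (g_BS c).

(* n_1, n_2, n_3 are the vector fields on the total space which are normal to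
   the fibres and satisfy b_i(n_j) = delta_ij. *)
Definition dual_normal_fields (c : R) (n : 'I_3 -> E -> E) : Prop :=
  forall j a p, fibre c a -> sphere p ->
    [/\ dot p (n j (a, p)).2 = 0,
        (forall u : R4, g_BS c (a, p) (n j (a, p)) (u, 0) = 0) &
        (forall i, b_ i (a, p) (n j (a, p)) = (i == j)%:R)].

Definition induced_triple (c : R) (n : 'I_3 -> E -> E) (p : R4) : @triple R :=
  fun k => pullback_form (fibre_map p) (fun m => contract (n k m) (phi c m)).

End BryantSalamon.

(** * Checks on the coframe *)

Section Checks.
Context {R : realType}.
Local Notation R4 := 'rV[R]_4.

Lemma wedge_covectors (V : Type) (f g : V -> R) (u w : V) :
  wedge (covector f) (covector g) (vec2 u w) = f u * g w - f w * g u.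
Proof.
pose M : 'M[R]_2 := \matrix_(i, j) (if i == ord0 then f else g) (vec2 u w j).
have -> : wedge (covector f) (covector g) (vec2 u w) = \det M.
  rewrite /wedge /covector mulr1 invr1 mul1r /determinant.
  apply: eq_bigr => s _; rewrite big_ord_recl big_ord1 !mxE /= -mulrA.
  by congr (_ * (_ * _)); congr (f _) || congr (g _); congr (vec2 _ _ (s _)); apply: val_inj.
by rewrite (expand_det_row _ ord0) big_ord_recl big_ord1 /cofactor !det_mx11 !mxE /= /vec2 /=; ring.
Qed.

Lemma derive_linear (f : R4 -> R^o) (x v : R4) :
  (forall h, f (h *: v + x) = h * f v + f x) -> 'D_v f x = f v.
Proof.
move=> fE; rewrite /derive; apply: cvg_lim => //.
have fv : (fun _ : R => f v) @ (0 : R)^' --> f v by exact: cvg_cst.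
apply: cvg_trans fv.
apply: near_eq_cvg; apply: filterS (nbhs_dnbhs_neq (0 : R)) => h h0.
by rewrite /= fE addrK /GRing.scale /= mulKf.
Qed.

Lemma sum4 (F : 'I_4 -> R) : \sum_i F i = F 0 + F 1 + F 2 + F 3.
Proof.
rewrite !big_ord_recl big_ord0 addr0 !addrA.
by congr (_ + _ + _ + _); congr F; apply: val_inj.
Qed.

Lemma row4E (a b c d : R) :
  (row4 a b c d 0 0 = a) * (row4 a b c d 0 1 = b) *
  (row4 a b c d 0 2 = c) * (row4 a b c d 0 3 = d).
Proof. by rewrite /row4 !mxE. Qed.

Lemma sigmaE (j : 'I_3) (p v : R4) : sigma j p v = - 2 *
  tnth [tuple
    - p 0 1 * v 0 0 + p 0 0 * v 0 1 + p 0 3 * v 0 2 - p 0 2 * v 0 3;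
    - p 0 2 * v 0 0 - p 0 3 * v 0 1 + p 0 0 * v 0 2 + p 0 1 * v 0 3;
    - p 0 3 * v 0 0 + p 0 2 * v 0 1 - p 0 1 * v 0 2 + p 0 0 * v 0 3] j.
Proof.
rewrite /sigma /dot sum4 /qmul !row4E /basis !mxE.
by case: j => [[|[|[|//]]] ?]; rewrite (tnth_nth 0) /=; ring.
Qed.

(* Left invariance. *)
Lemma sigma_left_invariant (q p v : R4) (j : 'I_3) : sphere q ->
  sigma j (qmul q p) (qmul q v) = sigma j p v.
Proof.
rewrite /sphere /= /dot sum4 => q1.
rewrite -[RHS]mul1r -[X in X * _]q1 !sigmaE /qmul !row4E.
by case: j => [[|[|[|//]]] ?]; rewrite !(tnth_nth 0) /=; ring.
Qed.

(* d sigma_1 = sigma_2 /\ sigma_3 and its cyclic permutations, on vectors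
   tangent to S^3. *)
Lemma sigma_structure (p u v : R4) (j : 'I_3) :
  sphere p -> dot p u = 0 -> dot p v = 0 ->
  ext_derive (fun q => covector (sigma j q)) p (vec2 u v) =
  wedge (covector (sigma (j + 1) p)) (covector (sigma (j + 2) p)) (vec2 u v).
Proof.
move=> p1 pu pv; rewrite wedge_covectors /ext_derive big_ord_recl big_ord1 /=.
rewrite /covector /vec2 /= expr0 mul1r expr1 mulN1r.
rewrite !derive_linear; [|move=> h; rewrite !sigmaE !mxE..]; last 2 first.
- by case: j => [[|[|[|//]]] ?]; rewrite !(tnth_nth 0) /=; ring.
- by case: j => [[|[|[|//]]] ?]; rewrite !(tnth_nth 0) /=; ring.
pose s k w := - sigma k p w / 2 : R.
have coord w : dot p w = 0 -> w = qmul p (row4 0 (s 0 w) (s 1 w) (s 2 w)).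
  move: p1; rewrite /sphere /= /dot !sum4 => p1 pw.
  apply/rowP => i; rewrite -[LHS]mul1r -[X in X * _]p1.
  have -> : i = 0 \/ i = 1 \/ i = 2 \/ i = 3 -> 
     (p 0 0 * p 0 0 + p 0 1 * p 0 1 + p 0 2 * p 0 2 + p 0 3 * p 0 3) * w 0 i = 
     p 0 i * (p 0 0 * w 0 0 + p 0 1 * w 0 1 + p 0 2 * w 0 2 + p 0 3 * w 0 3) + 
    qmul p (row4 0 (s 0 w) (s 1 w) (s 2 w)) 0 i.
    by move=> [|[|[]]] ->; rewrite /qmul !row4E /s !sigmaE !(tnth_nth 0) /=; field.
  - by rewrite pw mulr0 add0r.
  - by case: i => [[|[|[|[|//]]]] ?]; [left|right;left|right;right;left|right;right;right]; apply: val_inj.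
rewrite (coord u pu) (coord v pv).
move: (s) => x; clear s coord pu pv.
pose N := p 0 0 * p 0 0 + p 0 1 * p 0 1 + p 0 2 * p 0 2 + p 0 3 * p 0 3.
have N1 : N = 1 by move: p1; rewrite /sphere /= /dot sum4.
rewrite -[LHS]mul1r -{1}N1 !sigmaE /qmul !row4E /N.
by case: j => [[|[|[|//]]] ?]; rewrite !(tnth_nth 0) /=; ring.
Qed.
(* The b_j are orthonormal for the curvature 1 metric. *)
Lemma b_orthonormal (m s t : R4 * R4) : sphere m.2 -> dot m.2 s.2 = 0 ->
  \sum_(j < 3) b_ j m s * b_ j m t = dot s.2 t.2.
Proof.
rewrite /sphere /= => p1 ps.
suff -> : \sum_(j < 3) b_ j m s * b_ j m t =
    dot m.2 m.2 * dot s.2 t.2 - dot m.2 s.2 * dot m.2 t.2.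
  by rewrite p1 ps mul1r mul0r subr0.
rewrite !big_ord_recl big_ord0 addr0 /b_ !sigmaE /dot !sum4 !(tnth_nth 0) /=.
by field.
Qed.

End Checks.

(* Main.v *)
(** Since the forms b_j vanish on the fibres, g_c restricts to
    4 (c + r^2)^(-1/3) |da|^2 and the induced triple to 4 sqrt 3 times the standard
    one.  In the coordinate R = 3 r^(2/3) the metric is
    (1 + 27 c R^(-3))^(-1/3) (dR^2 + (4/9) R^2 g_{S^3}); all components are symbols,
    of which every derivative lowers the order of growth by one, and the factor
    differs from 1 by a symbol of order -3: this gives the rate -3.

    That the cone metric is not smooth at the origin in any chart is seen on
    distances.  In a smooth metric, the points y and -y are at distance about |y|
    from the origin and about 2 |y| from each other.  In the cone, whose link has
    diameter 2 pi / 3 < pi, two points at distance at most d from the apex can be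
    joined by a path of length at most (11/6) d. *)

From HB Require Import structures.
From mathcomp Require Import all_boot all_order all_algebra all_fingroup.
From mathcomp Require Import all_classical all_reals all_analysis.
From mathcomp Require Import ring lra.
Require Import Defs.
Import Order.TTheory GRing.Theory Num.Theory.
Import numFieldNormedType.Exports.

Set Implicit Arguments.
Unset Strict Implicit.
Unset Printing Implicit Defensive.

Local Open Scope classical_set_scope.
Local Open Scope ring_scope.

Section Germs.
Context {R : realType} {V W : normedModType R}.
Implicit Types f g : V -> W.

Lemma near_eq_differentiable f g (x : V) :
  {near x, f =1 g} -> differentiable f x -> differentiable g x.
Proof.
move=> fg df.
have zo : (g \- f) \o shift x = cst ((g \- f) x) + (0 : V -> W) +o_ (0 : V) id.
  apply/eqaddoP => e e0.
  have : \forall y \near (0 : V), f (y + x) = g (y + x).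
    by move: fg; rewrite [X in X -> _](near_shift 0) subr0.
  apply: filterS => y fgy; rewrite /= !fctE /= fgy (nbhs_singleton fg).
  by rewrite !subrr addr0 subrr normr0 mulr_ge0 // ltW.
have zc : continuous (0 : V -> W) by exact: cst_continuous.
have dz : 'd (g \- f) x = (\0 : {linear V -> W}) :> (V -> W).
  by apply: diff_unique.
have -> : g = f + (g \- f) by apply/funext => y; rewrite !fctE addrC subrK.
apply: differentiableD => //; apply/diff_locallyP; rewrite dz; split => //.
Qed.

Lemma open_eq_near (U : set V) f g (x : V) :
  open U -> U x -> (forall y, U y -> f y = g y) -> {near x, f =1 g}.
Proof. by move=> oU Ux fg; apply: filterS (open_nbhs_nbhs (conj oU Ux)). Qed.

Lemma open_eq_derive (U : set V) f g (x v : V) :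
  open U -> U x -> (forall y, U y -> f y = g y) -> 'D_v f x = 'D_v g x.
Proof. by move=> oU Ux fg; apply: near_eq_derive; exact: open_eq_near fg. Qed.

Lemma open_eq_differentiable (U : set V) f g (x : V) :
  open U -> U x -> (forall y, U y -> f y = g y) ->
  differentiable f x -> differentiable g x.
Proof. by move=> oU Ux fg; apply: near_eq_differentiable; exact: open_eq_near fg. Qed.

End Germs.

Section Dot.
Context {R : realType} {n : nat}.
Implicit Types u v w : 'rV[R]_n.

Lemma dotC u v : dot u v = dot v u.
Proof. by apply: eq_bigr => i _; rewrite mulrC. Qed.

Lemma dotDl u v w : dot (u + v) w = dot u w + dot v w.
Proof. by rewrite /dot -big_split; apply: eq_bigr => i _; rewrite mxE mulrDl. Qed.

Lemma dotZl a u v : dot (a *: u) v = a * dot u v.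
Proof. by rewrite /dot mulr_sumr; apply: eq_bigr => i _; rewrite mxE mulrA. Qed.

Lemma dotDr u v w : dot u (v + w) = dot u v + dot u w.
Proof. by rewrite dotC dotDl !(dotC u). Qed.

Lemma dotZr a u v : dot u (a *: v) = a * dot u v.
Proof. by rewrite dotC dotZl dotC. Qed.

Lemma dot0l u : dot 0 u = 0.
Proof. by rewrite -(scale0r u) dotZl mul0r. Qed.

Lemma dotNl u v : dot (- u) v = - dot u v.
Proof. by rewrite -scaleN1r dotZl mulN1r. Qed.

Lemma dot_ge0 u : 0 <= dot u u.
Proof. by apply: sumr_ge0 => i _; rewrite -expr2 sqr_ge0. Qed.

Lemma dot_eq0 u : (dot u u == 0) = (u == 0).
Proof.
apply/eqP/eqP => [|->]; last by rewrite dot0l.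
move=> /psumr_eq0P u0; apply/rowP => i; rewrite mxE; apply/eqP.
rewrite -sqrf_eq0 expr2 u0 // => j _; rewrite -expr2 sqr_ge0 //.
Qed.

Lemma dot_gt0 u : (0 < dot u u) = (u != 0).
Proof. by rewrite lt_neqAle dot_ge0 andbT eq_sym dot_eq0. Qed.

Lemma dot_basisl u i : dot (basis i) u = u 0 i.
Proof.
rewrite /dot (bigD1 i) //= big1 ?addr0 => [|j ji]; rewrite !mxE !eqxx /=.
  by rewrite mul1r.
by rewrite (negPf ji) mul0r.
Qed.

End Dot.

Section InnerProducts.
Context {R : realType} {n : nat}.
Local Notation V := 'rV[R]_n.

Definition inner_product (B : V -> V -> R) :=
  [/\ (forall u v, B u v = B v u),
      (forall s u v w, B (s *: u + v) w = s * B u w + B v w) &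
      (forall u, u != 0 -> 0 < B u u)].

Context (B : V -> V -> R) (HB : inner_product B).
Let BC u v : B u v = B v u. Proof. by case: HB. Qed.
Let BL s u v w : B (s *: u + v) w = s * B u w + B v w. Proof. by case: HB. Qed.

Lemma ip_pos u : u != 0 -> 0 < B u u. Proof. by case: HB => _ _; apply. Qed.

Lemma ip0l v : B 0 v = 0.
Proof. by have := BL (-1) 0 0 v; rewrite scaler0 addr0 mulN1r addNr. Qed.

Lemma ip_ge0 u : 0 <= B u u.
Proof. by have [->|/ip_pos/ltW //] := eqVneq u 0; rewrite ip0l. Qed.

Lemma ipZl s u v : B (s *: u) v = s * B u v.
Proof. by rewrite -[s *: u]addr0 BL ip0l addr0. Qed.

Lemma ipDl u v w : B (u + v) w = B u w + B v w.
Proof. by rewrite -[u]scale1r BL mul1r scale1r. Qed.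

Lemma ipZr s u v : B u (s *: v) = s * B u v.
Proof. by rewrite BC ipZl BC. Qed.

Lemma ipDr u v w : B u (v + w) = B u v + B u w.
Proof. by rewrite BC ipDl !(BC u). Qed.

Lemma ip_suml (I : Type) (r : seq I) (c : I -> R) (F : I -> V) v :
  B (\sum_(i <- r) c i *: F i) v = \sum_(i <- r) c i * B (F i) v.
Proof.
by elim: r => [|i r IH]; rewrite ?big_nil ?ip0l // !big_cons BL IH.
Qed.

Lemma ip_coordl u v : B u v = \sum_i u 0 i * B (basis i) v.
Proof. by rewrite {1}[u]row_sum_delta ip_suml. Qed.

Lemma ip_coord u v : B u v = \sum_i \sum_j u 0 i * v 0 j * B (basis i) (basis j).
Proof.
rewrite ip_coordl; apply: eq_bigr => i _; rewrite BC ip_coordl mulr_sumr.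
by apply: eq_bigr => j _; rewrite BC mulrA.
Qed.

Lemma ip_CS u v : B u v ^+ 2 <= B u u * B v v.
Proof.
have [->|v0] := eqVneq v 0; first by rewrite BC !ip0l expr0n mulr0.
have vv := ip_pos v0; have := ip_ge0 (B v v *: u + (- B u v) *: v).
rewrite !(ipDl, ipDr, ipZl, ipZr) (BC v u) => H.
have : 0 <= B v v * (B u u * B v v - B u v ^+ 2).
  by apply: le_trans H _; rewrite le_eqVlt; apply/orP; left; apply/eqP; ring.
by rewrite pmulr_rge0 // subr_ge0.
Qed.

(* The coordinate functionals are represented by the rows of the inverse Gram
   matrix, so that Cauchy-Schwarz bounds them. *)
Lemma ip_coord_bound : exists2 M, 0 < M & forall (v : V) i, v 0 i ^+ 2 <= M * B v v.
Proof.
pose G : 'M[R]_n := \matrix_(i, j) B (basis i) (basis j).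
have BG u v : B u v = (u *m G *m v^T) 0 0.
  rewrite ip_coord exchange_big mxE; apply: eq_bigr => j _; rewrite !mxE mulr_suml.
  by apply: eq_bigr => i _; rewrite !mxE mulrAC.
have Gu : G \in unitmx.
  rewrite -row_free_unit -kermx_eq0; apply/eqP/row_matrixP => i; rewrite row0.
  apply/eqP/negPn/negP => /ip_pos; rewrite BG.
  have /sub_kermxP -> := row_sub i (kermx G).
  by rewrite mul0mx mxE ltxx.
have GT : G^T = G by apply/matrixP => i j; rewrite !mxE BC.
pose a i : V := basis i *m invmx G.
have va v i : B v (a i) = v 0 i.
  by rewrite BG trmx_mul trmx_inv GT -mulmxA mulKVmx // -[RHS]dot_basisl dotC !mxE;
    apply: eq_bigr => j _; rewrite !mxE.
exists (1 + \sum_i B (a i) (a i)).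
  by rewrite ltr_wpDr // sumr_ge0 // => i _; exact: ip_ge0.
move=> v i; rewrite -(va v i) (le_trans (ip_CS _ _)) // mulrC ler_wpM2r ?ip_ge0 //.
rewrite (bigD1 i) //= addrCA lerDl addr_ge0 // sumr_ge0 // => j _; exact: ip_ge0.
Qed.

End InnerProducts.

Section EuclideanNorm.
Context {R : realType} {n : nat}.
Implicit Types u v : 'rV[R]_n.

Lemma dot_inner_product : inner_product (@dot R n).
Proof.
split=> [u v|s u v w|u]; first exact: dotC.
  by rewrite dotDl dotZl.
by rewrite dot_gt0.
Qed.

Lemma dot_CS u v : dot u v ^+ 2 <= dot u u * dot v v.
Proof. exact: ip_CS dot_inner_product u v. Qed.

Lemma enorm_ge0 u : 0 <= enorm u. Proof. exact: sqrtr_ge0. Qed.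

Lemma sqr_enorm u : enorm u ^+ 2 = dot u u.
Proof. by rewrite sqr_sqrtr // dot_ge0. Qed.

Lemma enorm_gt0 u : (0 < enorm u) = (u != 0).
Proof. by rewrite sqrtr_gt0 dot_gt0. Qed.

Lemma dot_le_enorm u v : `|dot u v| <= enorm u * enorm v.
Proof.
rewrite -sqrtrM ?dot_ge0 // -sqrtr_sqr ler_sqrt ?dot_CS //.
by rewrite mulr_ge0 // dot_ge0.
Qed.

Lemma coord_le_enorm u i : `|u 0 i| <= enorm u.
Proof.
rewrite -dot_basisl (le_trans (dot_le_enorm _ _)) //.
by rewrite {1}/enorm dot_basisl mxE !eqxx sqrtr1 mul1r.
Qed.

Lemma enormE u : enorm u = dot u u `^ 2^-1.
Proof. by rewrite powR12_sqrt // dot_ge0. Qed.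

Lemma enorm_dotE u a : enorm u `^ a = dot u u `^ (a / 2).
Proof. by rewrite enormE -powRrM mulrC. Qed.

End EuclideanNorm.

(** * Symbol classes and smooth functions *)

Section Symbols.
Context {R : realType} {n : nat}.
Local Notation V := 'rV[R]_n.
Implicit Types f g : V -> R^o.

Lemma coord_derive i (x u : V) : 'D_u (fun y : V => y 0 i : R^o) x = u 0 i.
Proof.
rewrite deriveE; last exact: differentiable_coord.
have @f : {linear V -> R^o}.
  by exists (fun N : V => N 0 i); do 2![eexists]; do ?[constructor];
     rewrite ?mxE// => ? *; rewrite ?mxE//; move=> ?; rewrite !mxE.
by rewrite (_ : (fun _ => _) = f) // (@diff_lin _ _ _ f) //; exact: coord_continuous.
Qed.

(* The symbol class S^mu truncated at N derivatives: each derivative lowers the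
   order mu of growth by one.  Growth is only required on the set A, so that
   A = set0 leaves mere smoothness on U. *)
Fixpoint symb (A U : set V) (N : nat) (mu : R) (f : V -> R^o) : Prop :=
  (exists C, forall x, A x -> `|f x| <= C * enorm x `^ mu) /\
  if N is N'.+1 then
    (forall x, U x -> differentiable f x) /\
    forall v, symb A U N' (mu - 1) ('D_v f)
  else True.

Context {A U : set V} (oU : open U) (AU : A `<=` U)
  (A1 : forall x, A x -> 1 <= enorm x).
Local Notation S := (symb A U).

Lemma symb_eq N mu f g : (forall x, U x -> f x = g x) -> S N mu f -> S N mu g.
Proof.
elim: N mu f g => [|N IH] mu f g fg /= [[C fC] H];
  (split; [exists C => x Ax; rewrite -fg ?fC //; exact: AU | ]) => //.
case: H => df Df; split => [x Ux|v].
  exact: (open_eq_differentiable oU Ux fg (df x Ux)).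
by apply: IH (Df v) => x Ux; apply: open_eq_derive oU Ux fg.
Qed.

Lemma symb_differentiable N mu f x : S N.+1 mu f -> U x -> differentiable f x.
Proof. by case=> _ [df _]; exact: df. Qed.

Lemma symb_derive N mu f v : S N.+1 mu f -> S N (mu - 1) ('D_v f).
Proof. by case=> _ [_ Df]; exact: Df. Qed.

Lemma symb_derive_eq N mu f v : S N.+1 (mu + 1) f -> S N mu ('D_v f).
Proof. by move=> /(symb_derive v); rewrite addrK. Qed.

Lemma symb_bound N mu f : S N mu f ->
  exists2 C, 0 <= C & forall x, A x -> `|f x| <= C * enorm x `^ mu.
Proof.
case: N => [|N] [[C fC] _]; exists `|C| => // x Ax; apply: le_trans (fC x Ax) _;
  by rewrite ler_wpM2r ?powR_ge0 ?ler_norm.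
Qed.

Lemma symbW N mu f : S N.+1 mu f -> S N mu f.
Proof.
elim: N mu f => [|N IH] mu f /= [H1 [H2 H3]]; split=> //.
by split => // v; apply: IH; apply: H3.
Qed.

Lemma symb_le N mu nu f : mu <= nu -> S N mu f -> S N nu f.
Proof.
elim: N mu nu f => [|N IH] mu nu f mn Sf; have [C C0 fC] := symb_bound Sf.
all: have bd : exists C, forall x, A x -> `|f x| <= C * enorm x `^ nu by
  exists C => x Ax; apply: le_trans (fC x Ax) _; rewrite ler_wpM2l // ler_powR // A1.
  by [].
case: Sf => _ [df Df]; split => //; split => // v.
by apply: IH (Df v); rewrite lerB.
Qed.

Lemma symbD N mu f g : S N mu f -> S N mu g -> S N mu (fun x => f x + g x).
Proof.
elim: N mu f g => [|N IH] mu f g Sf Sg;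
  have [C C0 fC] := symb_bound Sf; have [D D0 gD] := symb_bound Sg.
all: have bd : exists C, forall x, A x -> `|f x + g x| <= C * enorm x `^ mu by
  exists (C + D) => x Ax; rewrite mulrDl (le_trans (ler_normD _ _)) // lerD ?fC ?gD.
  by [].
case: (Sf) (Sg) => _ [df Df] [_ [dg Dg]]; split => //; split => [x Ux|v].
  by apply: differentiableD; [exact: df|exact: dg].
apply: symb_eq (IH _ _ _ (Df v) (Dg v)) => x Ux.
by rewrite deriveD //; apply: diff_derivable; [exact: df|exact: dg].
Qed.

Lemma symbM N mu nu f g :
  S N mu f -> S N nu g -> S N (mu + nu) (fun x => f x * g x : R^o).
Proof.
elim: N mu nu f g => [|N IH] mu nu f g Sf Sg;
  have [C C0 fC] := symb_bound Sf; have [D D0 gD] := symb_bound Sg.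
all: have bd : exists C, forall x, A x -> `|f x * g x| <= C * enorm x `^ (mu + nu) by
  exists (C * D) => x Ax; have x0 : 0 < enorm x by [apply: lt_le_trans (A1 Ax)];
  rewrite powRD ?(gt_eqF x0) ?implybT // normrM mulrACA ler_pM // ?fC ?gD.
  by [].
case: (Sf) (Sg) => _ [df Df] [_ [dg Dg]]; split => //; split => [x Ux|v].
  by apply: differentiableM; [exact: df|exact: dg].
have S1 := IH _ _ _ _ (symbW Sf) (Dg v).
have S2 := IH _ _ _ _ (symbW Sg) (Df v).
have E : nu + (mu - 1) = mu + nu - 1 by rewrite addrCA addrA.
rewrite E in S2; rewrite addrA in S1.
apply: symb_eq (symbD S1 S2) => x Ux.
by rewrite (@deriveM _ _ f g) //; apply: diff_derivable; [exact: df|exact: dg].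
Qed.

Lemma symb0 N mu : S N mu (fun=> 0).
Proof.
elim: N mu => [|N IH] mu; (split; [by exists 0 => x _; rewrite normr0 mul0r|]) => //.
split => [x _|v]; first exact: differentiable_cst.
by apply: symb_eq (IH (mu - 1)) => x _; rewrite derive_cst.
Qed.

Lemma symb_cst N c : S N 0 (fun=> c).
Proof.
have bd : exists C, forall x, A x -> `|c| <= C * enorm x `^ 0.
  by exists `|c| => x _; rewrite powRr0 mulr1.
case: N => [|N]; split => //.
split => [x _|v]; first exact: differentiable_cst.
by apply: symb_eq (symb0 N _) => x _; rewrite derive_cst.
Qed.

Lemma symbZ N mu c f : S N mu f -> S N mu (fun x => c * f x : R^o).
Proof. by move=> Sf; have := symbM (symb_cst N c) Sf; rewrite add0r. Qed.

Lemma symbN N mu f : S N mu f -> S N mu (fun x => - f x).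
Proof. by move=> /(symbZ (-1)); apply: symb_eq => x _; rewrite mulN1r. Qed.

Lemma symbB N mu f g : S N mu f -> S N mu g -> S N mu (fun x => f x - g x).
Proof. by move=> Sf Sg; apply: symbD Sf (symbN Sg). Qed.

Lemma symb_sum N mu (I : Type) (r : seq I) (P : pred I) (F : I -> V -> R^o) :
  (forall i, P i -> S N mu (F i)) -> S N mu (fun x => \sum_(i <- r | P i) F i x).
Proof.
move=> SF; elim: r => [|i r IH].
  by apply: symb_eq (symb0 N mu) => x _; rewrite big_nil.
case Pi : (P i); last by apply: symb_eq IH => x _; rewrite big_cons Pi.
by apply: symb_eq (symbD (SF i Pi) IH) => x _; rewrite big_cons Pi.
Qed.

Lemma symb_prod0 N (I : Type) (r : seq I) (F : I -> V -> R^o) :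
  (forall i, S N 0 (F i)) -> S N 0 (fun x => \prod_(i <- r) F i x : R^o).
Proof.
move=> SF; elim: r => [|i r IH].
  by apply: symb_eq (symb_cst N 1) => x _; rewrite big_nil.
have := symbM (SF i) IH; rewrite addr0.
by apply: symb_eq => x _; rewrite big_cons.
Qed.

Lemma symb_coord N i : S N 1 (fun x => x 0 i).
Proof.
have bd : exists C, forall x : V, A x -> `|x 0 i| <= C * enorm x `^ 1.
  by exists 1 => x _; rewrite powRr1 ?enorm_ge0 // mul1r coord_le_enorm.
case: N => [|N]; split => //.
split => [x _|v]; first exact: differentiable_coord.
have := symb_cst N (v 0 i); rewrite -(subrr 1); apply: symb_eq => x _.
by rewrite coord_derive.
Qed.

Lemma symb_dot N : S N 2 (fun x => dot x x).
Proof.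
apply: symb_sum => i _; rewrite (_ : 2 = 1 + 1) //.
by apply: symbM; exact: symb_coord.
Qed.

Lemma is_derive_powR_comp f (a : R) x v : 0 < f x -> differentiable f x ->
  differentiable (fun y => f y `^ a : R^o) x /\
  'D_v (fun y => f y `^ a : R^o) x = a * f x `^ (a - 1) * 'D_v f x.
Proof.
move=> fx df; have ip := is_derive1_powR a fx.
have dp : differentiable (fun y : R => y `^ a : R^o) (f x).
  by apply/derivable1_diffP; exact: ex_derive.
have dc := differentiable_comp df dp.
split=> //; rewrite deriveE // (diff_comp df dp) /= -(deriveE v df).
apply: etrans (congr1 (@^~ ('D_v f x)) (diff1E dp)) _.
by rewrite derive1E derive_val /GRing.scale /= mulrC.
Qed.

Lemma symb_powR N mu f (a : R) :
  (forall x, U x -> 0 < f x) ->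
  (exists2 c, 0 < c & forall x, A x -> c * enorm x `^ mu <= f x) ->
  S N mu f -> S N (a * mu) (fun x => f x `^ a : R^o).
Proof.
move=> f0 [c c0 cf] Sf; have [C C0 fC] := symb_bound Sf.
have bd a' : exists C, forall x, A x -> `|f x `^ a'| <= C * enorm x `^ (a' * mu).
  exists (c `^ a' + C `^ a') => x Ax; rewrite ger0_norm ?powR_ge0 //.
  have fx := f0 x (AU Ax).
  have := fC x Ax; rewrite gtr0_norm // => fCx.
  have w0 : 0 <= enorm x `^ mu by rewrite powR_ge0.
  rewrite (mulrC a') powRrM mulrDl -!powRM // ?(ltW c0) //.
  have [a0|a0] := leP 0 a'.
    rewrite (le_trans _ (_ : (C * enorm x `^ mu) `^ a' <= _)) ?lerDr ?powR_ge0 //.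
    by apply: ge0_ler_powR => //; rewrite nnegrE ?ltW // (lt_le_trans fx).
  rewrite (le_trans _ (_ : (c * enorm x `^ mu) `^ a' <= _)) ?lerDl ?powR_ge0 //.
  have cw : 0 < c * enorm x `^ mu.
    by rewrite mulr_gt0 // powR_gt0 // (lt_le_trans ltr01) // A1.
  rewrite -[a']opprK !(powRN _ (- a')) lef_pV2 ?posrE ?powR_gt0 //.
  by apply: ge0_ler_powR; rewrite ?nnegrE ?oppr_ge0 ?cf // ltW.
elim: N a Sf => [|N IH] a Sf; first by [].
case: (Sf) => _ [df Df]; split => //; split => [x Ux|v].
  exact: (is_derive_powR_comp a 0 (f0 x Ux) (df x Ux)).1.
have := symbM (symbZ a (IH (a - 1) (symbW Sf))) (Df v).
have -> : (a - 1) * mu + (mu - 1) = a * mu - 1 by ring.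
by apply: symb_eq => x Ux; exact/esym/(is_derive_powR_comp a v (f0 x Ux) (df x Ux)).2.
Qed.

Lemma symb_dot_powR N (a : R) : (forall x, U x -> x != 0) ->
  S N (a * 2) (fun x => dot x x `^ a : R^o).
Proof.
move=> U0; apply: symb_powR => [x /U0||]; [by rewrite dot_gt0| |exact: symb_dot].
by exists 1 => // x _; rewrite mul1r enorm_dotE mulfV // powRr1 ?dot_ge0.
Qed.

End Symbols.

Section Smooth.
Context {R : realType} {n : nat}.
Local Notation V := 'rV[R]_n.
Context (U : set V) (oU : open U).

(* The order mu is immaterial, the growth condition being empty. *)
Definition smooth_fun (f : V -> R^o) := forall N mu, symb set0 U N mu f.

Lemma smooth_fun_order N mu nu f : symb set0 U N mu f -> symb set0 U N nu f.
Proof.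
elim: N mu nu f => [|N IH] mu nu f [_ H]; (split; first by exists 0).
  by [].
by case: H => df Df; split => // v; apply: IH (Df v).
Qed.

Lemma smooth_fun_eq f g : (forall x, U x -> f x = g x) -> smooth_fun f -> smooth_fun g.
Proof. by move=> fg Sf N mu; apply: symb_eq fg (Sf N mu) => // x []. Qed.

Lemma smooth_cst c : smooth_fun (fun=> c).
Proof. by move=> N mu; exact: smooth_fun_order (symb_cst oU (@sub0set _ U) N c). Qed.

Lemma smooth_coord i : smooth_fun (fun x => x 0 i).
Proof. by move=> N mu; exact: smooth_fun_order (symb_coord oU (@sub0set _ U) N i). Qed.

Lemma smoothD f g : smooth_fun f -> smooth_fun g -> smooth_fun (fun x => f x + g x).
Proof. by move=> Sf Sg N mu; apply: symbD => // x []. Qed.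

Lemma smoothM f g : smooth_fun f -> smooth_fun g -> smooth_fun (fun x => f x * g x).
Proof.
by move=> Sf Sg N mu; rewrite -(addr0 mu); apply: symbM => // x [].
Qed.

Lemma smooth_dot : smooth_fun (fun x => dot x x).
Proof.
by move=> N mu; apply: smooth_fun_order (symb_dot oU (@sub0set _ U) _ N) => x [].
Qed.

Lemma smooth_powR f a : (forall x, U x -> 0 < f x) -> smooth_fun f ->
  smooth_fun (fun x => f x `^ a).
Proof.
move=> f0 Sf N mu; apply: (@smooth_fun_order _ (a * 0)).
by apply: symb_powR => //; exists 1.
Qed.

Lemma smooth_on_iter (f : V -> R^o) : smooth_fun f -> smooth_on U f.
Proof.
move=> Sf s; elim/last_ind: s f Sf => [|s v IH] f Sf x Ux.
  exact: symb_differentiable (Sf 1%N 0) Ux.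
rewrite /iter_derive foldr_rcons; apply: (IH ('D_v f)) => // N mu.
exact/symb_derive_eq.
Qed.

Lemma smooth_rV m (F : V -> 'rV[R]_m) :
  (forall i, smooth_fun (fun x => F x 0 i)) -> smooth_on U F.
Proof.
move=> SF s; elim/last_ind: s F SF => [|s v IH] F SF x Ux.
all: have dF y : U y -> differentiable F y by [
  move=> Uy; rewrite (_ : F = \sum_(i < m) (fun y => F y 0 i *: basis i));
    [apply: differentiable_sum => i; apply: differentiableZl;
     exact: symb_differentiable (SF i 1%N 0) Uy
    |apply/funext => z; apply/rowP => j; rewrite fct_sumE summxE (bigD1 j) //= big1 => [|i ij];
     rewrite !mxE eqxx /= ?eqxx ?mulr1 ?addr0 // eq_sym (negPf ij) mulr0]].
  exact: dF.
rewrite /iter_derive foldr_rcons; apply: (IH ('D_v F)) => // i N mu.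
apply: symb_eq (symb_derive_eq v (SF i N.+1 (mu + 1))) => // y Uy.
by rewrite derive_mx ?mxE //; exact/diff_derivable/dF.
Qed.

End Smooth.

Section Radial.
Context {R : realType} {n : nat}.
Local Notation V := 'rV[R]_n.
Implicit Types x u v : V.

Lemma open_neq0 : open (~` [set (0 : V)]).
Proof. by apply/closed_openC/accessible_closed_set1/hausdorff_accessible/norm_hausdorff. Qed.

Lemma neq0P x : (~` [set (0 : V)]) x <-> x != 0.
Proof. by split => [/= /eqP|/eqP]. Qed.

Lemma dot_powR_derive (a : R) x u : x != 0 ->
  differentiable (fun y : V => dot y y `^ a : R^o) x /\
  'D_u (fun y : V => dot y y `^ a : R^o) x = a * dot x x `^ (a - 1) * (2 * dot x u).
Proof.
move=> x0; have oT : open [set: V] by exact: openT.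
have S2 := @symb_dot R n set0 setT oT (fun _ _ => I) (fun _ => False_ind _) 1.
have d2 : differentiable (fun y : V => dot y y : R^o) x by exact: symb_differentiable S2 I.
have dc i : differentiable (fun y : V => y 0 i : R^o) x by exact: differentiable_coord.
have D2 : 'D_u (fun y : V => dot y y : R^o) x = 2 * dot x u.
  rewrite (_ : (fun y => _) =
      \sum_i ((fun y : V => y 0 i : R^o) * (fun y : V => y 0 i : R^o))); last first.
    by apply/funext => y; rewrite fct_sumE.
  rewrite derive_sum => [|i]; last first.
    by apply/diff_derivable; exact: differentiableM.
  rewrite /dot mulr_sumr; apply: eq_bigr => i _.
  have di : derivable (fun y : V => y 0 i : R^o) x u by exact/diff_derivable.
  rewrite (@deriveM _ _ (fun y : V => y 0 i : R^o)) // !coord_derive.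
  by rewrite /GRing.scale /=; ring.
have := @is_derive_powR_comp R n (fun y => dot y y) a x u _ d2.
by rewrite dot_gt0 D2; apply.
Qed.

Definition radial (k a : R) x : V := (k * dot x x `^ a) *: x.

Lemma dot_powR_smooth (a : R) : smooth_fun (~` [set (0 : V)]) (fun x => dot x x `^ a).
Proof.
apply: (smooth_powR open_neq0); last exact: smooth_dot open_neq0.
by move=> x /neq0P; rewrite dot_gt0.
Qed.

Lemma radial_coord_smooth k a i :
  smooth_fun (~` [set (0 : V)]) (fun x => radial k a x 0 i).
Proof.
have o := open_neq0.
apply: (@smooth_fun_eq _ _ _ o (fun x => k * dot x x `^ a * x 0 i)).
  by move=> x _; rewrite mxE.
apply: (smoothM o); last exact: smooth_coord o _.
by apply: (smoothM o); [exact: smooth_cst|exact: dot_powR_smooth].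
Qed.

Lemma radial_smooth k a : smooth_on (~` [set 0]) (radial k a).
Proof. exact: (smooth_rV open_neq0 (radial_coord_smooth k a)). Qed.

Lemma radial_differentiable k a x : x != 0 -> differentiable (radial k a) x.
Proof. by move=> /neq0P; exact: (@radial_smooth k a [::]). Qed.

Lemma radial_derive k a x u : x != 0 ->
  'D_u (radial k a) x = (k * dot x x `^ a) *: (u + (2 * a * dot x u / dot x x) *: x).
Proof.
move=> x0; have xx : dot x x != 0 by rewrite dot_eq0.
rewrite derive_mx; last exact/diff_derivable/radial_differentiable.
apply/rowP => i; rewrite !mxE.
have [dp Dp] := dot_powR_derive a u x0.
have dk : derivable (fun y : V => dot y y `^ a : R^o) x u by exact/diff_derivable.
have dc : derivable (fun y : V => y 0 i : R^o) x u.
  by apply/diff_derivable; exact: differentiable_coord.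
have -> : (fun t => radial k a t 0 i) =
    k *: ((fun y : V => dot y y `^ a : R^o) * (fun y : V => y 0 i : R^o)).
  by apply/funext => y; rewrite mxE !fctE -mulrA.
rewrite deriveZ; last exact: derivableM.
rewrite deriveM // Dp coord_derive powRD; last by rewrite implybE xx orbT.
by rewrite powR_inv1 ?dot_ge0 // /GRing.scale /=; field.
Qed.

Lemma radial_dot k a x : dot (radial k a x) (radial k a x) =
  k ^+ 2 * (dot x x `^ a) ^+ 2 * dot x x.
Proof. by rewrite dotZl dotZr mulrA -expr2 exprMn. Qed.

Lemma radial_eq0 k a x : 0 < k -> x != 0 -> radial k a x != 0.
Proof.
move=> k0 x0; rewrite scaler_eq0 negb_or x0 andbT mulf_neq0 ?gt_eqF //.
by rewrite powR_gt0 // dot_gt0.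
Qed.

Lemma radialK (k a k' a' : R) x : 0 < k -> 0 < k' -> 2 * a * a' + a + a' = 0 ->
  k' * k `^ (2 * a' + 1) = 1 -> x != 0 -> radial k' a' (radial k a x) = x.
Proof.
move=> k0 k'0 aa kk x0; have xx : 0 < dot x x by rewrite dot_gt0.
rewrite {1}/radial radial_dot /radial scalerA -[RHS]scale1r; congr (_ *: _).
have r0 : 0 <= dot x x by exact: ltW.
rewrite !powRM ?mulr_ge0 ?sqr_ge0 ?powR_ge0 ?(ltW k0) //.
have kE : k `^ (2 * a' + 1) = k `^ a' * k `^ a' * k.
  rewrite (_ : 2 * a' = a' + a'); last by ring.
  by rewrite !powRD ?implybE ?(gt_eqF k0) ?orbT // powRr1 // ltW.
have E : dot x x `^ a `^ a' * dot x x `^ a `^ a' * dot x x `^ a' * dot x x `^ a = 1.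
  rewrite -!powRrM -!powRD ?implybE ?(gt_eqF xx) ?orbT //.
  by rewrite (_ : _ + _ = 0) ?powRr0 // -aa; ring.
by rewrite -kk kE -[RHS]mulr1 -E; ring.
Qed.

End Radial.

(** * The metric induced on the fibres *)

Section ConformalMetrics.
Context {R : realType} {n : nat}.
Local Notation V := 'rV[R]_n.
Implicit Types (x u v : V) (U : set V).

Lemma partial_eq U i (f g : V -> R) x : open U -> U x ->
  (forall y, U y -> f y = g y) -> partial i f x = partial i g x.
Proof. by move=> oU Ux fg; exact: open_eq_derive oU Ux fg. Qed.

Lemma partial_cst i c x : partial i (fun=> c) x = 0.
Proof. exact: derive_cst. Qed.

Lemma conformal_riemannian U (F : V -> R) : open U ->
  (forall x, U x -> 0 < F x) -> smooth_fun U F ->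
  riemannian U (fun x u v => F x * dot u v).
Proof.
move=> oU F0 SF; split.
- by move=> x u v _; rewrite dotC.
- by move=> x s u v w _; rewrite dotDl dotZl; ring.
- by move=> x u Ux u0; rewrite mulr_gt0 ?F0 ?dot_gt0.
- move=> u v; refine (smooth_on_iter _); apply: (smoothM oU) => //.
  exact: smooth_cst.
Qed.

Lemma constant_metric_flat U (c : R) (g : @metric R n) : open U ->
  (forall x u v, U x -> g x u v = c * dot u v) -> flat U g.
Proof.
move=> oU gE; have C l i j y : U y -> christoffel g y l i j = 0.
  move=> Uy; rewrite /christoffel big1 ?mulr0 // => m _.
  have P i1 i2 i3 : partial i1 (fun z => gram g z i2 i3) y = 0.
    rewrite -(partial_cst i1 (c * dot (@basis R n i2) (basis i3)) y).
    by apply: (partial_eq _ oU Uy) => z Uz; rewrite mxE gE.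
  by rewrite !P addr0 subr0 mulr0.
move=> x Ux l k i j; rewrite /riemann big1 => [|m _]; last by rewrite !C // !mul0r subr0.
have P i1 i2 i3 i4 : partial i1 (fun y => christoffel g y i2 i3 i4) x = 0.
  rewrite -(partial_cst i1 0 x).
  by apply: (partial_eq _ oU Ux) => z Uz; rewrite C.
by rewrite !P subr0 addr0.
Qed.

Lemma conformal_conformally_flat U (F : V -> R) : open U ->
  (forall x, U x -> 0 < F x) -> smooth_fun U F ->
  conformally_flat U (fun x u v => F x * dot u v).
Proof.
move=> oU F0 SF x Ux; exists U, (fun y => F y `^ (-1)); split; first by split.
split; first by exact: (smooth_on_iter (smooth_powR oU (-1) F0 SF)).
  by move=> y Uy; rewrite powR_gt0 // F0.
apply: (@constant_metric_flat U 1) => // y u v Uy.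
by rewrite powR_inv1 ?(ltW (F0 y Uy)) // mulKf ?mul1r // gt_eqF // F0.
Qed.

Lemma cone_chart_metricE (s : R) x u v : x != 0 ->
  cone_chart_metric (fun x u v => s * round_metric x u v) x u v =
  (1 - s) * (dot x u * dot x v / dot x x) + s * dot u v.
Proof.
move=> x0; have xx : 0 < dot x x by rewrite dot_gt0.
have polarE : @polar R n = fun y => (dot y y `^ 2^-1 : R^o, radial 1 (- 2^-1) y).
  by apply/funext => y; rewrite /polar /radial enormE mul1r powRN.
have D w : 'D_w (@polar R n) x =
    (dot x w * dot x x `^ (- 2^-1), dot x x `^ (- 2^-1) *: (w - (dot x w / dot x x) *: x)).
  have [d1 D1] := dot_powR_derive 2^-1 w x0.
  have d2 := @radial_differentiable R n 1 (- 2^-1) x x0.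
  rewrite polarE deriveE; last exact: differentiable_pair.
  rewrite diff_pair //= -(deriveE _ d1) -(deriveE _ d2) D1 radial_derive // mul1r.
  congr (_, _ *: (_ + _)).
    rewrite (_ : 2^-1 - 1 = - 2^-1); [by field|by field].
  by rewrite -scaleNr; congr (_ *: _); field; exact: lt0r_neq0.
rewrite /cone_chart_metric /pullback_metric /cone_metric !D /=.
rewrite /round_metric dotZl dotZr -/(enorm x) sqr_enorm.
rewrite -!scaleNr !(dotDl, dotDr, dotZl, dotZr) (dotC u x).
have E : dot x x `^ (- 2^-1) * dot x x `^ (- 2^-1) = (dot x x)^-1.
  rewrite -powRD ?implybE ?(gt_eqF xx) ?orbT // -(powR_inv1 (ltW xx)).
  by congr (_ `^ _); field.
rewrite /GRing.scale /=; set q := dot x x `^ _ in E *.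
transitivity (q * q * (dot x u * dot x v)
    + dot x x * (s * (q * q * (dot u v - dot x u * dot x v / dot x x)))).
  by field; exact: lt0r_neq0.
by rewrite E; field; exact: lt0r_neq0.
Qed.

End ConformalMetrics.

Section FibreMetric.
Context {R : realType}.
Local Notation V := 'rV[R]_4.
Implicit Types (x u v p : V) (c : R).

Lemma fibre_map_derive p x u : 'D_u (fibre_map p) x = (u, 0).
Proof.
have di : differentiable (id : V -> V) x := @ex_diff _ _ _ _ _ _ _ (is_diff_id x).
have dc : differentiable (cst p : V -> V) x := differentiable_cst p x.
rewrite deriveE; last exact: differentiable_pair di dc.
rewrite (diff_pair di dc) /=; congr (_, _).
  by rewrite -(deriveE u di) derive_id.
by rewrite -(deriveE u dc) derive_cst.
Qed.

Lemma b_vertical (j : 'I_3) (m : V * V) u : b_ j m (u, 0) = 0.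
Proof.
rewrite /b_ sigmaE !mxE; case: j => [[|[|[|//]]] ?].
all: by rewrite (tnth_nth 0) /=; ring.
Qed.

Lemma zeta_vertical (k : 'I_4) (m : V * V) u : zeta k m (u, 0) = u 0 k.
Proof.
have r0 (j : 'I_3) : rho j m (u, 0) = 0.
  have -> : rho j m (u, 0) = - 2^-1 * b_ j m (u, 0) by rewrite /rho /b_; field.
  by rewrite b_vertical mulr0.
rewrite /zeta !r0 !mulr0 !addr0 !subr0.
case: k => [[|[|[|[|//]]]] ?]; rewrite (tnth_nth 0) /=; congr (u _ _); exact: val_inj.
Qed.

Lemma fibre_metricE c p :
  fibre_metric c p = fun x u v => 4 * (c + dot x x) `^ (- 3^-1) * dot u v.
Proof.
apply/funext => x; apply/funext => u; apply/funext => v.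
rewrite /fibre_metric /pullback_metric !fibre_map_derive /g_BS /=.
rewrite big1 => [|j _]; last by rewrite b_vertical mul0r.
rewrite mulr0 add0r; congr (_ * _).
by apply: eq_bigr => k _; rewrite !zeta_vertical.
Qed.

Lemma conformal_factor_pos c x : 0 <= c -> fibre c x -> 0 < c + dot x x.
Proof.
rewrite /fibre; case: eqP => [-> _ /neq0P|/eqP c0 cp _].
  by rewrite add0r dot_gt0.
by rewrite ltr_wpDr ?dot_ge0 // lt_neqAle eq_sym c0.
Qed.

Lemma open_fibre c : open (fibre c : set V).
Proof. by rewrite /fibre; case: ifP => _; [exact: open_neq0|exact: openT]. Qed.

Lemma conformal_factor_smooth c : 0 <= c ->
  smooth_fun (fibre c) (fun x : V => 4 * (c + dot x x) `^ (- 3^-1)).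
Proof.
move=> c0; have o := @open_fibre c.
apply: (smoothM o); first exact: smooth_cst.
apply: (smooth_powR o); first by move=> x; exact: conformal_factor_pos.
by apply: (smoothD o); [exact: smooth_cst|exact: smooth_dot].
Qed.

Lemma fibre_metric_riemannian c p : 0 <= c -> riemannian (fibre c) (fibre_metric c p).
Proof.
move=> c0; rewrite fibre_metricE; apply: conformal_riemannian.
- exact: open_fibre.
- by move=> x fx; rewrite mulr_gt0 ?powR_gt0 ?conformal_factor_pos.
- exact: conformal_factor_smooth.
Qed.

Lemma fibre_metric_conformally_flat c p : 0 <= c ->
  conformally_flat (fibre c) (fibre_metric c p).
Proof.
move=> c0; rewrite fibre_metricE; apply: conformal_conformally_flat.
- exact: open_fibre.
- by move=> x fx; rewrite mulr_gt0 ?powR_gt0 ?conformal_factor_pos.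
- exact: conformal_factor_smooth.
Qed.

(* The radial function R on the cone is 3 r^(2/3), that is r = (R/3)^(3/2). *)
Definition cone_to_fibre : V -> V := radial (3 `^ (- (3 / 2))) 4^-1.
Definition fibre_to_cone : V -> V := radial 3 (- 6^-1).

Lemma cone_to_fibreK x : x != 0 -> fibre_to_cone (cone_to_fibre x) = x.
Proof.
apply: radialK; rewrite ?powR_gt0 //; first by field.
rewrite -powRrM -[X in X * _]powRr1 // -powRD; last by rewrite implybE pnatr_eq0 orbT.
by rewrite (_ : _ + _ = 0) ?powRr0 //; field.
Qed.

Lemma fibre_to_coneK x : x != 0 -> cone_to_fibre (fibre_to_cone x) = x.
Proof.
apply: radialK; rewrite ?powR_gt0 //; first by field.
rewrite -powRD; last by rewrite implybE pnatr_eq0 orbT.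
by rewrite (_ : _ + _ = 0) ?powRr0 //; field.
Qed.

Lemma cone0E : @cone R 4 0 = ~` [set 0].
Proof. by apply/seteqP; split => x; rewrite /cone /= enorm_gt0 => /eqP. Qed.

Lemma cone_fibre_diffeo :
  diffeo (@cone R 4 0) (~` [set 0]) cone_to_fibre fibre_to_cone.
Proof.
rewrite cone0E; split; [| |exact: radial_smooth|exact: radial_smooth].
- move=> x /neq0P x0; split; last exact: cone_to_fibreK.
  by apply/neq0P; rewrite radial_eq0 ?powR_gt0.
- move=> x /neq0P x0; split; last exact: fibre_to_coneK.
  by apply/neq0P; rewrite radial_eq0.
Qed.

Definition deviation c x : R := (1 + 27 * c * dot x x `^ (- (3 / 2))) `^ (- 3^-1).

Lemma pullback_fibre_metric c p x u v : 0 <= c -> x != 0 ->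
  pullback_metric cone_to_fibre (fibre_metric c p) x u v =
  deviation c x * cone_chart_metric (fun x u v => 4 / 9 * round_metric x u v) x u v.
Proof.
move=> c0 x0; have xx : 0 < dot x x by rewrite dot_gt0.
have k2 : (3 `^ (- (3 / 2))) ^+ 2 = 27^-1 :> R.
  rewrite -powR_mulrn ?powR_ge0 // -powRrM.
  rewrite (_ : _ * _ = - 3%:R); last by field.
  by rewrite powRN powR_mulrn //; congr (_^-1); ring.
have q2 a : (dot x x `^ a) ^+ 2 = dot x x `^ (2 * a).
  by rewrite -powR_mulrn ?powR_ge0 // -powRrM mulrC.
rewrite cone_chart_metricE // /pullback_metric fibre_metricE radial_dot.
rewrite !radial_derive // dotZl dotZr !(dotDl, dotDr, dotZl, dotZr) (dotC u x).
set k := 3 `^ _ in k2 *; set q := dot x x `^ 4^-1.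
have -> : c + k ^+ 2 * q ^+ 2 * dot x x =
    27^-1 * dot x x `^ (3 / 2) * (1 + 27 * c * dot x x `^ (- (3 / 2))).
  have h : dot x x `^ (3 / 2) = q ^+ 2 * dot x x.
    rewrite (_ : 3 / 2 = 2 * 4^-1 + 1); last by field.
    by rewrite powRD ?implybE ?(gt_eqF xx) ?orbT // powRr1 ?(ltW xx) // q2.
  have q0 : q != 0 by rewrite gt_eqF // powR_gt0.
  rewrite powRN k2 h.
  by field; rewrite q0 gt_eqF.
rewrite powRM ?mulr_ge0 ?addr_ge0 ?mulr_ge0 ?powR_ge0 ?invr_ge0 //.
rewrite powRM ?powR_ge0 ?invr_ge0 // -/(deviation c x).
have -> : 27^-1 `^ (- 3^-1) = 3 :> R.
  rewrite (_ : 27^-1 = 3 `^ (- 3%:R)); last first.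
    by rewrite powRN powR_mulrn //; congr (_^-1); ring.
  rewrite -powRrM (_ : _ * _ = 1) ?powRr1 //; by field.
rewrite -powRrM (_ : 3 / 2 * - 3^-1 = - 2^-1); last by field.
have E : dot x x `^ (- 2^-1) * q ^+ 2 = 1.
  rewrite q2 -powRD ?implybE ?(gt_eqF xx) ?orbT //.
  by rewrite (_ : _ + _ = 0) ?powRr0 //; field.
set A := dot x x `^ (- 2^-1) in E *.
transitivity (12 * deviation c x * (A * q ^+ 2) * k ^+ 2 *
  (dot u v + 5 / 4 * (dot x u * dot x v / dot x x))).
  by field; exact: lt0r_neq0.
by rewrite E k2; field; exact: lt0r_neq0.
Qed.

Lemma cone_fibre_isometric p :
  isometric (@cone R 4 0) (cone_chart_metric (fun x u v => 4 / 9 * round_metric x u v))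
    (~` [set 0]) (fibre_metric 0 p).
Proof.
exists cone_to_fibre, fibre_to_cone; split; first exact: cone_fibre_diffeo.
move=> x u v; rewrite cone0E => /neq0P x0.
by rewrite pullback_fibre_metric // /deviation mulr0 mul0r addr0 powR1 mul1r.
Qed.

End FibreMetric.

Section Asymptotics.
Context {R : realType} {n : nat}.
Local Notation V := 'rV[R]_n.
Context (A : set V) (U0 : A `<=` ~` [set 0]) (A1 : forall x, A x -> 1 <= enorm x).
Local Notation U := (~` [set (0 : V)]).
Local Notation S := (symb A U).
Local Notation o := (@open_neq0 R n).

Lemma symb_partial N mu i (f : V -> R) :
  S N.+1 mu f -> S N (mu - 1) (partial i f).
Proof. exact: symb_derive. Qed.

Lemma symb_rank1 N i j : S N 0 (fun x => x 0 i * x 0 j / dot x x).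
Proof.
rewrite (_ : 0 = 1 + 1 + (-1) * 2); last by ring.
apply: (symb_eq o U0 (f := fun x => x 0 i * x 0 j * dot x x `^ (-1))).
  by move=> x _; rewrite powR_inv1 ?dot_ge0.
apply: (symbM o U0 A1); first by apply: (symbM o U0 A1); exact: (symb_coord o U0).
by apply: (symb_dot_powR o U0 A1) => x /neq0P.
Qed.

Section ConeMetric.
Context (s : R) (s0 : s != 0).
Local Notation g0 := (cone_chart_metric (fun x u v : V => s * round_metric x u v)).

Lemma dot_basis i j : dot (basis i : V) (basis j) = (i == j)%:R.
Proof. by rewrite dot_basisl mxE eqxx /= eq_sym. Qed.

Lemma cone_gramE x i j : x != 0 ->
  g0 x (basis i) (basis j) = (1 - s) * (x 0 i * x 0 j / dot x x) + s * (i == j)%:R.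
Proof.
move=> x0; rewrite cone_chart_metricE // (dotC x (basis i)) (dotC x (basis j)).
by rewrite dot_basis !dot_basisl.
Qed.

Lemma cone_cogramE x i j : x != 0 ->
  cogram g0 x i j = (1 - s^-1) * (x 0 i * x 0 j / dot x x) + s^-1 * (i == j)%:R.
Proof.
move=> x0; have xx : dot x x != 0 by rewrite dot_eq0.
pose P : 'M[R]_n := (dot x x)^-1 *: (x^T *m x).
have PP : P *m P = P.
  rewrite /P -scalemxAl -scalemxAr mulmxA -(mulmxA x^T) (mx11_scalar (x *m x^T)).
  have -> : (x *m x^T) 0 0 = dot x x by rewrite mxE; apply: eq_bigr => k _; rewrite mxE.
  by rewrite mul_mx_scalar -scalemxAl !scalerA; congr (_ *: _); field.
have PE k l : P k l = x 0 k * x 0 l / dot x x.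
  by rewrite !mxE big_ord1 mxE mulrC.
clearbody P.
have gE : gram g0 x = (1 - s) *: P + s%:M.
  by apply/matrixP => k l; rewrite mxE cone_gramE // !mxE PE mulr_natr.
have BE : gram g0 x *m ((1 - s^-1) *: P + s^-1%:M) = 1%:M.
  rewrite gE mulmxDl !mulmxDr -!scalemxAl -!scalemxAr PP !mul_scalar_mx !mul_mx_scalar.
  rewrite scale_scalar_mx mulfV // addrA !scalerA -!scalerDl.
  by rewrite [X in X *: P](_ : _ = 0) ?scale0r ?add0r //; field.
have gu : gram g0 x \in unitmx by case/mulmx1_unit: BE.
rewrite /cogram -[invmx _]mulmx1 -BE mulmxA mulVmx // mul1mx.
by rewrite mxE [X in X + _]mxE PE mxE mulr_natr.
Qed.

Lemma symb_cone_metric N i j : S N 0 (fun x => g0 x (basis i) (basis j)).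
Proof.
apply: (symb_eq o U0 (f := fun x => (1 - s) * (x 0 i * x 0 j / dot x x) + s * (i == j)%:R)).
  by move=> x /neq0P x0; rewrite cone_gramE.
apply: (symbD o U0); last exact: (symb_cst o U0).
by apply: (symbZ o U0 A1); exact: symb_rank1.
Qed.

Lemma symb_cone_cogram N i j : S N 0 (fun x => cogram g0 x i j).
Proof.
apply: (symb_eq o U0 (f := fun x => (1 - s^-1) * (x 0 i * x 0 j / dot x x) + s^-1 * (i == j)%:R)).
  by move=> x /neq0P x0; rewrite cone_cogramE.
apply: (symbD o U0); last exact: (symb_cst o U0).
by apply: (symbZ o U0 A1); exact: symb_rank1.
Qed.

Lemma symb_cone_christoffel N l i j : S N (-1) (fun x => christoffel g0 x l i j).
Proof.
apply: (symbZ o U0 A1); apply: (symb_sum o U0) => m _.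
rewrite -(add0r (-1)); apply: (symbM o U0 A1); first exact: symb_cone_cogram.
have P i1 i2 i3 : S N (-1) (partial i1 (fun y => gram g0 y i2 i3)).
  rewrite -(sub0r 1); apply: symb_partial.
  apply: (symb_eq o U0 (f := fun x => g0 x (basis i2) (basis i3))).
    by move=> x _; rewrite mxE.
  exact: symb_cone_metric.
by apply: (symbB o U0 A1); [apply: (symbD o U0); exact: P|exact: P].
Qed.

Lemma symb_cov_derive k (T : tensor n k) mu :
  (forall N t, S N mu (fun x => T x t)) ->
  forall N t, S N (mu - 1) (fun x => cov_derive g0 T x t).
Proof.
move=> ST N t; apply: (symbB o U0 A1); first exact/symb_partial/ST.
apply: (symb_sum o U0) => m _; apply: (symb_sum o U0) => l _.
by rewrite addrC; apply: (symbM o U0 A1) => //; exact: symb_cone_christoffel.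
Qed.

Lemma symb_iter_cov_derive k (T : tensor n k) mu :
  (forall N t, S N mu (fun x => T x t)) ->
  forall j N t, S N (mu - j%:R) (fun x => @iter_cov_derive R n k g0 T j x t).
Proof.
move=> ST; elim=> [|j IH] N t /=; first by rewrite subr0.
have -> : mu - j.+1%:R = mu - j%:R - 1 by rewrite mulrSr; ring.
exact: symb_cov_derive.
Qed.

Lemma symb_tensor_norm k (T : tensor n k) mu :
  (forall N t, S N mu (fun x => T x t)) ->
  exists C, forall x, A x -> tensor_norm g0 T x <= C * enorm x `^ mu.
Proof.
move=> ST.
have : S 0 (mu + mu) (fun x => \sum_(p : k.-tuple 'I_n) \sum_(t : k.-tuple 'I_n)
    (\prod_(m < k) cogram g0 x (tnth p m) (tnth t m)) * T x p * T x t).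
  apply: (symb_sum o U0) => p _; apply: (symb_sum o U0) => t _.
  apply: (symbM o U0 A1) => //; rewrite -(add0r mu); apply: (symbM o U0 A1) => //.
  by apply: (symb_prod0 o U0 A1) => m; exact: symb_cone_cogram.
case=> -[C fC] _; exists (Num.sqrt `|C|) => x Ax; rewrite /tensor_norm.
set q := \sum_p _ in fC *.
have x1 : 0 < enorm x by apply: lt_le_trans (A1 Ax).
have E : enorm x `^ (mu + mu) = (enorm x `^ mu) ^+ 2.
  by rewrite powRD ?implybE ?(gt_eqF x1) ?orbT.
have -> : enorm x `^ mu = Num.sqrt ((enorm x `^ mu) ^+ 2).
  by rewrite sqrtr_sqr ger0_norm // powR_ge0.
rewrite -sqrtrM // ler_sqrt ?(mulr_ge0 (normr_ge0 C) (sqr_ge0 _)) //.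
apply: le_trans (ler_norm _) (le_trans (fC x Ax) _).
by rewrite E ler_wpM2r ?sqr_ge0 ?ler_norm.
Qed.

End ConeMetric.
End Asymptotics.

Section FibreAsymptotics.
Context {R : realType}.
Local Notation V := 'rV[R]_4.

Lemma deviation_bounds (e : R) : 0 <= e -> `|(1 + e) `^ (- 3^-1) - 1| <= e.
Proof.
move=> e0; have e1 : 1 <= 1 + e by rewrite lerDl.
rewrite ler0_norm; last first.
  by rewrite subr_le0 -[leRHS](powRr0 (1 + e)) ler_powR // oppr_le0 invr_ge0.
rewrite opprB lerBlDl -lerBlDr.
have : (1 + e) `^ (-1) <= (1 + e) `^ (- 3^-1).
  by rewrite ler_powR // lerN2 invf_le1 // ler1n.
apply: le_trans; rewrite powR_inv1 ?(le_trans ler01) //.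
rewrite -[leLHS]divr1 ler_pdivrMr // ler_pdivlMl ?(lt_le_trans ltr01) //.
by nra.
Qed.

Lemma fibre_metric_asymptotics (c : R) (p : V) : 0 < c ->
  asymptotically_conical setT (fibre_metric c p) (- 3)
    (fun x u v => 4 / 9 * round_metric x u v).
Proof.
move=> c0; have fT : fibre c = setT :> set V by rewrite /fibre gt_eqF.
split; first by rewrite oppr_lt0.
split; first by rewrite -fT; exact/fibre_metric_riemannian/ltW.
exists 0, [set 0], (@cone_to_fibre R), (@fibre_to_cone R); split.
  split => //; first exact: compact_set1.
  by rewrite setTD; exact: cone_fibre_diffeo.
move=> g0 T j.
pose A := [set x : V | 1 <= enorm x].
have A1 x : A x -> 1 <= enorm x by [].
have U0 : A `<=` ~` [set 0].
  by move=> x Ax; apply/neq0P; rewrite -enorm_gt0 (lt_le_trans ltr01).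
have o := @open_neq0 R 4.
have Se N : symb A (~` [set (0 : V)]) N (-3) (fun x => 27 * c * dot x x `^ (- (3 / 2)) : R^o).
  apply: (symbZ o U0 A1); rewrite (_ : -3 = - (3 / 2) * 2); last by field.
  by apply: (symb_dot_powR o U0 A1) => x /neq0P.
have e0 (x : V) : 0 <= 27 * c * dot x x `^ (- (3 / 2)).
  by rewrite !mulr_ge0 ?powR_ge0 ?(ltW c0).
have Sd1 N : symb A (~` [set (0 : V)]) N (-3) (fun x => deviation c x - 1).
  have [C C0 eC] := symb_bound (Se 0%N).
  have bd : exists C, forall x : V, A x -> `|deviation c x - 1| <= C * enorm x `^ (-3).
    exists C => x Ax; apply: le_trans (deviation_bounds (e0 x)) _.
    by rewrite -[leLHS]ger0_norm //; exact: eC.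
  have de x : x != 0 -> differentiable (fun x : V => 1 + 27 * c * dot x x `^ (- (3 / 2)) : R^o) x.
    move=> /neq0P x0; apply: differentiableD; first exact: differentiable_cst.
    exact: symb_differentiable (Se 1%N) x0.
  have pe (x : V) : 0 < 1 + 27 * c * dot x x `^ (- (3 / 2)) by rewrite ltr_wpDr.
  case: N => [|N]; split => //; split => [x /neq0P x0|v].
    apply: differentiableB; last exact: differentiable_cst.
    exact: (is_derive_powR_comp _ 0 (pe x) (de x x0)).1.
  have Sp : symb A (~` [set (0 : V)]) N 0 (fun x =>
      - 3^-1 * (1 + 27 * c * dot x x `^ (- (3 / 2))) `^ (- 3^-1 - 1) : R^o).
    apply: (symbZ o U0 A1); rewrite -(mulr0 (- 3^-1 - 1)); apply: (symb_powR o U0 A1).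
    - by move=> x _; exact: pe.
    - by exists 1 => // x _; rewrite powRr0 mulr1 lerDl.
    apply: (symbD o U0); first exact: (symb_cst o U0).
    by apply: (symb_le A1 _ (Se N)); rewrite oppr_le0.
  have := symbM o U0 A1 Sp (symb_derive v (Se N.+1)); rewrite add0r.
  apply: (symb_eq o U0) => x /neq0P x0.
  have [d D] := is_derive_powR_comp (- 3^-1) v (pe x) (de x x0).
  have dev : derivable (deviation c : V -> R^o) x v by exact/diff_derivable.
  rewrite deriveB // derive_cst subr0 D; congr (_ * _).
  rewrite deriveD ?derive_cst ?add0r //; apply/diff_derivable.
  by apply: (symb_differentiable (Se 1%N)); exact/neq0P.
have ST N t : symb A (~` [set (0 : V)]) N (-3) (fun x => T x t).
  have := symbM o U0 A1 (Sd1 N) (symb_cone_metric U0 A1 (4 / 9) N (tnth t 0) (tnth t 1)).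
  rewrite addr0; apply: (symb_eq o U0) => x /neq0P x0.
  by rewrite /T /metric_tensor pullback_fibre_metric ?(ltW c0) //= mulrBl mul1r.
have s0 : 4 / 9 != 0 :> R by rewrite mulf_neq0 ?invr_eq0 ?pnatr_eq0.
have [C CT] := symb_tensor_norm U0 A1 s0 (fun N => symb_iter_cov_derive U0 A1 s0 ST (j := j) N).
by exists C, 1 => x _ /ltW; exact: CT.
Qed.

End FibreAsymptotics.

Section NotFlat.
Context {R : realType}.
Local Notation V := 'rV[R]_4.

Lemma fibre_christoffel p (x : V) (l i j : 'I_4) : x != 0 ->
  christoffel (fibre_metric 0 p) x l i j =
  - 3^-1 * (((j == l)%:R * x 0 i + (i == l)%:R * x 0 j - (i == j)%:R * x 0 l)
    * dot x x `^ (- 1)).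
Proof.
move=> x0; have xx : 0 < dot x x by rewrite dot_gt0.
have gE y a b : gram (fibre_metric 0 p) y a b = 4 * (a == b)%:R * dot y y `^ (- 3^-1).
  rewrite mxE fibre_metricE add0r dot_basisl mxE eqxx /=.
  by rewrite mulrAC.
have cE a b : cogram (fibre_metric 0 p) x a b =
    (a == b)%:R * (4 * dot x x `^ (- 3^-1))^-1.
  rewrite /cogram (_ : gram _ x = (4 * dot x x `^ (- 3^-1))%:M).
    by rewrite invmx_scalar mxE [RHS]mulr_natl.
  by apply/matrixP => a' b'; rewrite gE mxE -mulr_natr; ring.
have PE a b d : partial a (fun y => gram (fibre_metric 0 p) y b d) x =
    4 * (b == d)%:R * (- 3^-1 * dot x x `^ (- 3^-1 - 1) * (2 * x 0 a)).
  have [d1 D1] := dot_powR_derive (- 3^-1) (basis a) x0.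
  rewrite /partial (_ : (fun y => _) =
      (4 * (b == d)%:R) *: (fun y : V => dot y y `^ (- 3^-1) : R^o)).
    rewrite deriveZ; last exact/diff_derivable.
    by rewrite D1 (dotC x) dot_basisl.
  by apply/funext => y; rewrite gE.
rewrite /christoffel (bigD1 l) //= big1 => [|m ml]; last first.
  by rewrite cE eq_sym (negPf ml) mul0r mul0r.
rewrite addr0 cE eqxx mulr1n !PE powRD ?implybE ?(gt_eqF xx) ?orbT //.
set q := dot x x `^ _; have q0 : q != 0 by rewrite gt_eqF ?powR_gt0.
by field.
Qed.

Lemma fibre_metric_not_flat (p : V) : ~ flat (~` [set 0]) (fibre_metric 0 p).
Proof.
move=> F; pose e0 : V := basis 0.
have e00 : e0 != 0.
  by apply/eqP => /rowP /(_ 0) /eqP; rewrite !mxE !eqxx oner_eq0.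
have ee : dot e0 e0 = 1 by rewrite dot_basisl mxE !eqxx.
have PE (a : R) (i k : 'I_4) : k != 0 ->
    partial i (fun y : V => a * (y 0 k * dot y y `^ (- 1))) e0 = a * (k == i)%:R.
  move=> k0; have [d1 D1] := dot_powR_derive (- 1) (basis i) e00.
  have dc : derivable (fun y : V => y 0 k : R^o) e0 (basis i).
    by apply/diff_derivable; exact: differentiable_coord.
  have d2 : derivable (fun y : V => dot y y `^ (- 1) : R^o) e0 (basis i).
    exact/diff_derivable.
  rewrite /partial (_ : (fun y => _) = a *: ((fun y : V => y 0 k : R^o) *
      (fun y : V => dot y y `^ (- 1) : R^o))) //.
  rewrite deriveZ; last exact: derivableM.
  rewrite deriveM // D1 coord_derive ee !powR1 /e0 !mxE !eqxx (negPf k0) /=.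
  by rewrite /GRing.scale /=; ring.
(* The plane of the fields d_1, d_2 at e0 is tangent to the sphere through e0,
   which is not isometric to a round sphere of radius equal to its distance to
   the apex. *)
have := F e0 (iffRL (neq0P _) e00) 1 2 1 2.
rewrite /riemann !sum4 !fibre_christoffel // ee !powR1.
rewrite (@partial_eq _ _ (~` [set 0]) 1 _
  (fun y : V => 3^-1 * (y 0 1 * dot y y `^ (- 1)))) //; last 3 first.
- exact: open_neq0.
- exact/neq0P.
- by move=> y /neq0P y0; rewrite fibre_christoffel //=; ring.
rewrite (@partial_eq _ _ (~` [set 0]) 2 _
  (fun y : V => - 3^-1 * (y 0 2 * dot y y `^ (- 1)))) //; last 3 first.
- exact: open_neq0.
- exact/neq0P.
- by move=> y /neq0P y0; rewrite fibre_christoffel //=; ring.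
rewrite !PE // /e0 !mxE /= => /eqP.
rewrite (_ : _ + _ = 5 / 9); last by field.
by rewrite mulf_eq0 invr_eq0 !pnatr_eq0.
Qed.

End NotFlat.

(** * Exterior algebra and the induced triples *)

Section Determinants.
Context {R : realType}.

Definition detn m (F : nat -> nat -> R) := \det (\matrix_(i < m, j < m) F i j).

Lemma detn_expand m F : detn m.+1 F =
  \sum_(k < m.+1) (-1) ^+ k * F 0 k * detn m (fun i j => F i.+1 (bump k j)).
Proof.
rewrite /detn (expand_det_row _ ord0); apply: eq_bigr => k _.
rewrite mxE /cofactor add0n mulrCA mulrA; congr (_ * \det _).
by apply/matrixP => i j; rewrite !mxE.
Qed.

Definition det2 (F : nat -> nat -> R) r s i j := F r i * F s j - F r j * F s i.

Lemma detn1 F : detn 1 F = F 0 0.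
Proof. by rewrite /detn det_mx11 mxE. Qed.

Lemma det3E F : detn 3 F =
  F 0 0 * det2 F 1 2 1 2 - F 0 1 * det2 F 1 2 0 2 + F 0 2 * det2 F 1 2 0 1.
Proof.
rewrite detn_expand !big_ord_recl big_ord0 !detn_expand.
rewrite !big_ord_recl !big_ord0 !detn1 /= /bump /= /det2.
by ring.
Qed.

Lemma det4E F : detn 4 F =
  det2 F 0 1 0 1 * det2 F 2 3 2 3 - det2 F 0 1 0 2 * det2 F 2 3 1 3
  + det2 F 0 1 0 3 * det2 F 2 3 1 2 + det2 F 0 1 1 2 * det2 F 2 3 0 3
  - det2 F 0 1 1 3 * det2 F 2 3 0 2 + det2 F 0 1 2 3 * det2 F 2 3 0 1.
Proof.
rewrite detn_expand !big_ord_recl big_ord0 !det3E /= /bump /= /det2.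
by ring.
Qed.

End Determinants.

Lemma ord3E : [/\ lift ord0 (ord0 : 'I_2) = 1, lift ord0 (lift ord0 (ord0 : 'I_1)) = 2,
  lshift 2 (ord0 : 'I_1) = 0, rshift 1 (0 : 'I_2) = 1 & rshift 1 (1 : 'I_2) = 2 :> 'I_3].
Proof. by split; apply: val_inj. Qed.

Lemma ord4E : [/\ lift ord0 (ord0 : 'I_3) = 1,
    lift ord0 (lift ord0 (ord0 : 'I_2)) = 2 &
    lift ord0 (lift ord0 (lift ord0 (ord0 : 'I_1))) = 3 :> 'I_4] /\
  [/\ lshift 2 (0 : 'I_2) = 0, lshift 2 (1 : 'I_2) = 1,
    rshift 2 (0 : 'I_2) = 2 & rshift 2 (1 : 'I_2) = 3 :> 'I_4].
Proof. by split; split; apply: val_inj. Qed.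

Section Wedges.
Context {R : realType} {V : Type}.
Implicit Types (a b c d : V -> R).

Lemma wedge11E a b (v : 'I_2 -> V) :
  wedge (covector a) (covector b) v = a (v 0) * b (v 1) - a (v 1) * b (v 0).
Proof.
rewrite -wedge_covectors; congr (wedge _ _ _); apply/funext => i.
by case: (unliftP ord0 i) => [j|] -> //; rewrite /vec2 /= (ord1 j); congr v; apply: val_inj.
Qed.

Definition eval_mx (f : seq (V -> R)) m (v : 'I_m.+1 -> V) (i j : nat) : R :=
  nth (fun=> 0) f i (v (inord j)).

Lemma wedge12E a b c (v : 'I_3 -> V) :
  wedge (covector a) (wedge (covector b) (covector c)) v = detn 3 (eval_mx [:: a; b; c] v).
Proof.
have [l1 l2 l3 l4 l5] := ord3E.
have D f g h : \sum_(s : 'S_3) (-1) ^+ odd_perm s * (f (v (s 0)) * g (v (s 1)) * h (v (s 2))) =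
    detn 3 (eval_mx [:: f; g; h] v).
  apply: eq_bigr => s _; rewrite !big_ord_recl big_ord0 mulr1 !mxE /eval_mx /= !inord_val !mulrA.
  by rewrite l1 l2.
transitivity (2^-1 * (detn 3 (eval_mx [:: a; b; c] v) - detn 3 (eval_mx [:: a; c;
  b] v))); last first.
  by rewrite !det3E /eval_mx /det2 /=; field.
rewrite -!D -sumrB; congr (_ * _); first by rewrite mul1r.
apply: eq_bigr => s _; rewrite wedge11E /covector -!mulrBr -!mulrA; congr (_ * _).
rewrite l3 l4 l5.
by ring.
Qed.

Lemma wedge22E a b c d (v : 'I_4 -> V) :
  wedge (wedge (covector a) (covector b)) (wedge (covector c) (covector d)) v =
  detn 4 (eval_mx [:: a; b; c; d] v).
Proof.
have [[l1 l2 l3] [l4 l5 l6 l7]] := ord4E.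
have D f g h k : \sum_(s : 'S_4) (-1) ^+ odd_perm s *
    (f (v (s 0)) * g (v (s 1)) * (h (v (s 2)) * k (v (s 3)))) =
    detn 4 (eval_mx [:: f; g; h; k] v).
  apply: eq_bigr => s _; rewrite !big_ord_recl big_ord0 mulr1 !mxE /eval_mx /= !inord_val !mulrA.
  by rewrite l1 l2 l3.
transitivity (4^-1 * (detn 4 (eval_mx [:: a; b; c; d] v) - detn 4 (eval_mx [:: b; a; c; d] v)
   - (detn 4 (eval_mx [:: a; b; d; c] v) - detn 4 (eval_mx [:: b; a; d; c] v)))); last first.
  by rewrite !det4E /eval_mx /det2 /=; field.
rewrite -!D -!sumrB; congr (_ * _); first by rewrite -natrM.
apply: eq_bigr => s _; rewrite !wedge11E /covector -!mulrBr -!mulrA; congr (_ * _).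
rewrite l4 l5 l6 l7.
by ring.
Qed.

Lemma wedge_subl k l (f g : @form R V k) (h : @form R V l) v :
  wedge (fun u => f u - g u) h v = wedge f h v - wedge g h v.
Proof.
rewrite /wedge -mulrBr -sumrB; congr (_ * _); apply: eq_bigr => s _.
by rewrite mulrBr mulrBl.
Qed.

Lemma wedge_subr k l (f : @form R V k) (g h : @form R V l) v :
  wedge f (fun u => g u - h u) v = wedge f g v - wedge f h v.
Proof.
by rewrite /wedge -mulrBr -sumrB; congr (_ * _); apply: eq_bigr => s _; rewrite mulrBr.
Qed.

Lemma wedge_scale k l (f : @form R V k) (g : @form R V l) s t v :
  wedge (fun u => s * f u) (fun u => t * g u) v = s * t * wedge f g v.
Proof.
rewrite /wedge mulrCA; congr (_ * _); rewrite mulr_sumr; apply: eq_bigr => p _.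
by move: (_ ^+ _) (f _) (g _) => x y z; ring.
Qed.

Lemma asd_tripleE (e : 'I_4 -> V -> R) (j : 'I_3) (v : 'I_2 -> V) :
  asd_triple e j v = tnth [tuple
    wedge (covector (e 0)) (covector (e 1)) v - wedge (covector (e 2)) (covector (e 3)) v;
    wedge (covector (e 0)) (covector (e 2)) v - wedge (covector (e 3)) (covector (e 1)) v;
    wedge (covector (e 0)) (covector (e 3)) v - wedge (covector (e 1)) (covector (e 2)) v] j.
Proof.
case: j => [[|[|[|//]]] ?]; rewrite (tnth_nth 0) /= /asd_triple.
all: by congr (wedge (covector (e _)) (covector (e _)) _ -
  wedge (covector (e _)) (covector (e _)) _); apply: val_inj.
Qed.

End Wedges.

Section Triples.
Context {R : realType}.
Local Notation V := 'rV[R]_4.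
Local Notation E := (V * V)%type.

Lemma standard_tripleE (j : 'I_3) (x : V) (v : 'I_2 -> V) :
  standard_triple j x v =
  let d (k l : 'I_4) := v 0 0 k * v 1 0 l - v 1 0 k * v 0 0 l in
  tnth [tuple d 0 1 - d 2 3; d 0 2 - d 3 1; d 0 3 - d 1 2] j.
Proof.
rewrite /standard_triple asd_tripleE.
by case: j => [[|[|[|//]]] ?]; rewrite !(tnth_nth 0) /= !wedge11E.
Qed.

Definition std_volume (x : V) : @form R V 4 :=
  fun v => - \det (\matrix_(i < 4, j < 4) v i 0 j).

Lemma wedge_standard (i j : 'I_3) (x : V) (v : 'I_4 -> V) :
  wedge (standard_triple i x) (standard_triple j x) v = 2 * (i == j)%:R * std_volume x v.
Proof.
pose e (k : nat) : V -> R := fun u => u 0 (inord k).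
have W a b c d : wedge (wedge (covector (e a)) (covector (e b)))
    (wedge (covector (e c)) (covector (e d))) v =
    detn 4 (fun r s => v (inord s) 0 (inord (nth 0%N [:: a; b; c; d] r))).
  rewrite wedge22E !det4E /det2 /eval_mx /= /e //.
have -> : std_volume x v = - detn 4 (fun r s => v (inord s) 0 (inord r)).
  rewrite /std_volume -det_tr; congr (- \det _); apply/matrixP => r s.
  by rewrite !mxE !inord_val.
have eE (k : 'I_4) : (fun u : V => u 0 k) = e k by apply/funext => u; rewrite /e inord_val.
have S k : standard_triple k x = fun w =>
    let t := tnth [tuple (1, 2, 3); (2, 3, 1); (3, 1, 2)]%N k in
    wedge (covector (e 0)) (covector (e t.1.1)) w
    - wedge (covector (e t.1.2)) (covector (e t.2)) w.
  apply/funext => w; rewrite /standard_triple asd_tripleE !eE.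
  by case: k => [[|[|[|//]]] ?]; rewrite !(tnth_nth (0, 0, 0)%N) !(tnth_nth 0).
rewrite !S /= wedge_subl !wedge_subr !W !det4E /det2.
case: i => [[|[|[|//]]] ?]; case: j => [[|[|[|//]]] ?]; rewrite !(tnth_nth (0, 0, 0)%N) /=.
all: rewrite ?eqxx -?val_eqE /= ?mulr1n ?mulr0n; ring.
Qed.

Lemma std_volume_form (U : set V) : open U -> volume_form U std_volume.
Proof.
move=> oU; split; last first.
  move=> x Ux; rewrite /std_volume oppr_eq0 (_ : \matrix_(_, _) _ = 1%:M) ?det1 ?oner_eq0 //.
  by apply/matrixP => i j; rewrite !mxE eqxx eq_sym.
split.
- move=> x Ux v i s u w /=; rewrite /std_volume.
  rewrite (@determinant_multilinear _ _ _ (\matrix_(k, l) (if k == i then u else v k) 0 l)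
     (\matrix_(k, l) (if k == i then w else v k) 0 l) i s 1).
  + by ring.
  + by apply/rowP => l; rewrite !mxE eqxx !mxE; ring.
  + by apply/matrixP => k l; rewrite !mxE -!(eq_sym i) (negPf (neq_lift _ _)).
  + by apply/matrixP => k l; rewrite !mxE -!(eq_sym i) (negPf (neq_lift _ _)).
- move=> x Ux v i j ij vij; rewrite /std_volume (determinant_alternate ij) ?oppr0 //.
  by move=> k; rewrite !mxE vij.
- by move=> v; apply: smooth_on_iter; exact: smooth_cst.
Qed.

Lemma standard_multiple_hypersymplectic (U : set V) (w : @triple R) (k : R) :
  open U -> 0 < k ->
  (forall i x v, U x -> w i x v = k * standard_triple i x v) -> hypersymplectic U w.
Proof.
move=> oU k0 wE; split.
  move=> i; split; last first.
    move=> x v Ux; rewrite /ext_derive big1 // => m _.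
    rewrite (@open_eq_derive _ _ _ U _
      (cst (k * standard_triple i x (fun j => v (lift m j))))) //.
      by rewrite derive_cst mulr0.
    by move=> y Uy; rewrite wE.
  split.
  - move=> x Ux v m s u z upd; rewrite !wE // !standard_tripleE.
    have [E|E] : (forall t, upd t 0 = t /\ upd t 1 = v 1) \/
        (forall t, upd t 0 = v 0 /\ upd t 1 = t).
      by case: m @upd => [[|[|//]] ?] upd; [left|right].
    1,2: have [-> ->] := E (s *: u + z); have [-> ->] := E u; have [-> ->] := E z;
      rewrite /= !mxE; by case: i => [[|[|[|//]]] ?]; rewrite !(tnth_nth 0) /=; ring.
  - move=> x Ux v a b ab vab; rewrite wE // standard_tripleE /=.
    have v01 : v 0 = v 1.
      case: a b ab vab => [[|[|//]] ai] [[|[|//]] bi] // _ H.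
        by apply: etrans (etrans _ H) _; congr v; apply: val_inj.
      by apply: etrans (etrans _ (esym H)) _; congr v; apply: val_inj.
    rewrite v01.
    by case: i => [[|[|[|//]]] ?]; rewrite !(tnth_nth 0) /=; ring.
  - move=> v; apply: smooth_on_iter;
    apply: (@smooth_fun_eq _ _ _ oU (cst (k * standard_triple i 0 v))).
      by move=> x Ux; rewrite wE.
    exact: smooth_cst.
exists std_volume, (fun=> (k ^+ 2)%:M); split.
- exact: std_volume_form.
- move=> x i j v Ux.
  have -> : w i x = fun u => k * standard_triple i x u by apply/funext => u; rewrite wE.
  have -> : w j x = fun u => k * standard_triple j x u by apply/funext => u; rewrite wE.
  rewrite wedge_scale wedge_standard mxE -mulr_natr.
  by move: (std_volume _ _) => z; ring.
- by move=> x _; rewrite tr_scalar_mx.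
- move=> x u _ u0; rewrite mul_mx_scalar -scalemxAl mxE.
  rewrite mulr_gt0 ?exprn_gt0 //.
  have -> : (u *m u^T) 0 0 = dot u u by rewrite mxE; apply: eq_bigr => i _; rewrite mxE.
  by rewrite dot_gt0.
Qed.

Lemma standard_hyperkahler : hyperkahler setT (@standard_triple R).
Proof.
split.
  apply: (@standard_multiple_hypersymplectic _ _ 1); [exact: openT|by []|].
  by move=> i x v _; rewrite mul1r.
exists std_volume, 1%:M, (fun=> 1); split.
- exact/std_volume_form/openT.
- by rewrite mul1mx trmx1.
- exact: det1.
- by [].
- move=> x i j v _.
  have E k : (fun v => 1 * \sum_l 1%:M k l * standard_triple l x v) = standard_triple k x.
    apply/funext => u; rewrite mul1r (bigD1 k) //= big1 => [|l lk]; rewrite mxE.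
      by rewrite eqxx mul1r addr0.
    by rewrite eq_sym (negPf lk) mul0r.
  by rewrite !E wedge_standard mxE.
Qed.

Section Fibre.
Context (c : R).

Lemma phi_vertical (a p u w : V) (n : E) (v : 'I_3 -> E) :
  v 0 = n -> v 1 = (u, 0) -> v 2 = (w, 0) ->
  phi c (a, p) v = 4 * Num.sqrt 3 *
    \sum_(j < 3) b_ j (a, p) n * standard_triple j a (vec2 u w).
Proof.
move=> v0 v1 v2; rewrite /phi.
have i0 : inord 0 = 0 :> 'I_3 by apply: val_inj; rewrite /= inordK.
have i1 : inord 1 = 1 :> 'I_3 by apply: val_inj; rewrite /= inordK.
have i2 : inord 2 = 2 :> 'I_3 by apply: val_inj; rewrite /= inordK.
have -> : vol_S3 (a, p) v = 0.
  rewrite /vol_S3 wedge12E det3E /det2 /eval_mx /= i0 i1 i2 v0 v1 v2 !b_vertical.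
  by ring.
rewrite mulr0 add0r; congr (_ * _); apply: eq_bigr => j _.
pose s := tnth [tuple (1, 2, 3); (2, 3, 1); (3, 1, 2)] j : 'I_4 * 'I_4 * 'I_4.
have -> : Omega j (a, p) = fun z =>
    wedge (covector (zeta 0 (a, p))) (covector (zeta s.1.1 (a, p))) z -
    wedge (covector (zeta s.1.2 (a, p))) (covector (zeta s.2 (a, p))) z.
  apply/funext => z; rewrite /Omega asd_tripleE /s.
  by case: j @s => [[|[|[|//]]] ?] s; rewrite !(tnth_nth (0, 0, 0)) !(tnth_nth 0).
rewrite wedge_subr !wedge12E !det3E /det2 /eval_mx /= i0 i1 i2 v0 v1 v2.
rewrite !b_vertical !zeta_vertical standard_tripleE /s /=.
by case: j @s => [[|[|[|//]]] ?] s; rewrite !(tnth_nth (0, 0, 0)) !(tnth_nth 0) /= /vec2 /=; ring.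
Qed.

Lemma fibre_coassociative (p : V) (U : set V) : coassociative c U (fibre_map p).
Proof.
move=> x v Ux; rewrite /pullback_form.
rewrite (@phi_vertical x p (v 1) (v 2) (v 0, 0)) ?fibre_map_derive //.
by rewrite big1 ?mulr0 // => j _; rewrite b_vertical mul0r.
Qed.

Lemma induced_tripleE (n : 'I_3 -> E -> E) (p : V) (k : 'I_3) (x : V) (v : 'I_2 -> V) :
  (forall j, b_ j (x, p) (n k (x, p)) = (j == k)%:R) ->
  induced_triple c n p k x v = 4 * Num.sqrt 3 * standard_triple k x v.
Proof.
move=> bn; rewrite /induced_triple /pullback_form /contract /fibre_map.
rewrite (@phi_vertical x p (v 0) (v 1) (n k (x, p))); last 3 first.
- by rewrite unlift_none.
- rewrite (_ : 1 = lift ord0 0); last exact: val_inj.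
  by rewrite liftK fibre_map_derive.
- rewrite (_ : 2 = lift ord0 1); last exact: val_inj.
  by rewrite liftK fibre_map_derive.
congr (_ * _); rewrite (bigD1 k) //= big1 => [|j jk]; rewrite bn ?eqxx ?(negPf jk) ?mul0r //.
by rewrite mul1r addr0 !standard_tripleE.
Qed.

Definition unit_normal (j : 'I_3) (m : E) : E :=
  let: (a, p) := m in
  let r i := 2^-1 * (i == j)%:R : R in
  (row4 (a 0 1 * r 0 + a 0 2 * r 1 + a 0 3 * r 2)
        (- a 0 0 * r 0 + a 0 3 * r 1 - a 0 2 * r 2)
        (- a 0 3 * r 0 - a 0 0 * r 1 + a 0 1 * r 2)
        (a 0 2 * r 0 - a 0 1 * r 1 - a 0 0 * r 2),
   - qmul p (basis (lift ord0 j))).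

Lemma unit_normal_dual : dual_normal_fields c unit_normal.
Proof.
move=> j a p _ p1.
have N (w : V) k : (- w) 0 k = - w 0 k by rewrite mxE.
have bE i : b_ i (a, p) (unit_normal j (a, p)) = (i == j)%:R.
  have {p1} : dot p p = 1 by [].
  rewrite /dot sum4 => p1; rewrite /b_ sigmaE /= !N /qmul !row4E -[RHS]mul1r -[X in _ = X * _]p1.
  case: i => [[|[|[|//]]] ?]; case: j => [[|[|[|//]]] ?];
    rewrite !(tnth_nth 0) -?val_eqE /= !mxE /=;
    by field.
have rE i : rho i (a, p) (unit_normal j (a, p)) = - 2^-1 * (i == j)%:R.
  by rewrite -bE /rho /b_; field.
split => //.
  rewrite /dot sum4 /= !N /qmul !row4E.
  by case: j {bE rE} => [[|[|[|//]]] ?]; rewrite !mxE /=; ring.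
move=> u; rewrite /g_BS big1 ?mulr0 ?add0r; last by move=> i _; rewrite b_vertical mulr0.
rewrite big1 ?mulr0 // => k _;
  suff -> : zeta k (a, p) (unit_normal j (a, p)) = 0 by rewrite mul0r.
rewrite /zeta !rE /= !row4E.
by case: k => [[|[|[|[|//]]]] ?]; rewrite (tnth_nth 0) /=; ring.
Qed.

Lemma induced_triples :
  (exists n, dual_normal_fields c n) /\
  (forall n, dual_normal_fields c n ->
    exists k : R, 0 < k /\
      forall p : V, sphere p ->
        hypersymplectic (fibre c) (induced_triple c n p) /\
        forall i x v, fibre c x ->
          induced_triple c n p i x v = k * standard_triple i x v).
Proof.
split; first by exists unit_normal; exact: unit_normal_dual.
move=> n dn; exists (4 * Num.sqrt 3);
  have k0 : 0 < 4 * Num.sqrt 3 :> R by rewrite mulr_gt0 ?sqrtr_gt0.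
split => // p p1.
have I i x v : fibre c x -> induced_triple c n p i x v = 4 * Num.sqrt 3 * standard_triple i x v.
  by move=> fx; apply: induced_tripleE => j; case: (dn i x p fx p1).
split; last exact: I.
exact: (standard_multiple_hypersymplectic (@open_fibre R c) k0 I).
Qed.

End Fibre.
End Triples.

(** * Regularity at the apex of the cone *)

Section Neighbourhoods.
Context {R : realType} {n : nat}.
Local Notation V := 'rV[R]_n.

Lemma nbhs0_dot (S : set V) : nbhs (0 : V) S ->
  exists2 d, 0 < d & forall x, dot x x < d -> S x.
Proof.
move=> /nbhs_ballP[e e0 eS]; exists (e ^+ 2); first exact: exprn_gt0.
move=> x xe; apply: eS; rewrite -ball_normE /ball_ /= sub0r normrN.
rewrite [ltLHS]mx_normrE; apply: bigmax_lt => // -[i j] _ /=.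
rewrite (ord1 i) -(ltr_pXn2r (n := 2)) ?nnegrE ?(ltW e0) // -normrX ger0_norm ?sqr_ge0 //.
apply: le_lt_trans xe; rewrite /dot (bigD1 j) //= expr2 lerDl.
by apply: sumr_ge0 => k _; rewrite -expr2 sqr_ge0.
Qed.

Lemma near0_dot (d : R) : 0 < d -> \forall x \near (0 : V), dot x x < d.
Proof.
move=> d0; have : {for (0 : V), continuous (fun x : V => dot x x : R^o)}.
  have S := @smooth_dot R n setT openT.
  exact: (differentiable_continuous (symb_differentiable (x := 0) (S 1%N 0) I)).
move=> /cvgrPdist_lt /(_ d d0); apply: filterS => x /=.
by rewrite dot0l sub0r normrN ger0_norm ?dot_ge0.
Qed.

Lemma near_metric_comparison (W : set V) (h : @metric R n) (e : R) :
  open W -> W 0 -> riemannian W h -> 0 < e ->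
  \forall y \near (0 : V), forall v, `|h y v v - h 0 v v| <= e * h 0 v v.
Proof.
move=> oW W0 [hC hL hP hS] e0.
have ipW y : W y -> inner_product (h y).
  by move=> Wy; split => [u v|s u v w|u u0]; [exact: hC|exact: hL|exact: hP].
have [M M0 hM] := ip_coord_bound (ipW 0 W0).
pose d := e / (M * (n ^ 2).+1%:R); have d0 : 0 < d by rewrite divr_gt0 // mulr_gt0.
have near_ij : \forall y \near (0 : V), forall ij : 'I_n * 'I_n,
    `|h y (basis ij.1) (basis ij.2) - h 0 (basis ij.1) (basis ij.2)| <= d.
  apply: (@filter_forall V ('I_n * 'I_n)%type (fun ij y =>
    `|h y (basis ij.1) (basis ij.2) - h 0 (basis ij.1) (basis ij.2)| <= d)
    (nbhs (0 : V)) _) => -[i j] /=.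
  have := differentiable_continuous (hS (basis i) (basis j) [::] 0 W0).
  move=> /cvgrPdist_lt /(_ d d0); apply: filterS => y /= H.
  by rewrite distrC ltW.
have nW : \forall y \near (0 : V), W y by exact: open_nbhs_nbhs.
near=> y => v; have Wy : W y by near: y.
have yd ij : `|h y (basis ij.1) (basis ij.2) - h 0 (basis ij.1) (basis ij.2)| <= d.
  by move: ij; near: y.
rewrite (ip_coord (ipW y Wy)) (ip_coord (ipW 0 W0) v v) -sumrB.
set X := \sum_(i < n) \sum_(j < n) v 0 i * v 0 j * h 0 _ _.
have XE : X = h 0 v v by rewrite [RHS](ip_coord (ipW 0 W0)).
have X0 : 0 <= X by rewrite XE (ip_ge0 (ipW 0 W0)).
have vv i j : `|v 0 i * v 0 j| <= M * X.
  rewrite -[leLHS]ger0_norm // -ler_sqr ?nnegrE ?mulr_ge0 ?(ltW M0) //.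
  rewrite normr_id -normrX ger0_norm ?sqr_ge0 // exprMn [leRHS]expr2.
  by rewrite ler_pM ?sqr_ge0 // XE.
apply: (@le_trans _ _ (\sum_(i < n) \sum_(j < n) M * X * d)).
  apply: le_trans (ler_norm_sum _ _ _) (ler_sum _ _) => i _; rewrite -sumrB.
  apply: le_trans (ler_norm_sum _ _ _) (ler_sum _ _) => j _.
  by rewrite -mulrBr normrM ler_pM // (yd (i, j)).
rewrite !sumr_const !card_ord -mulrnA -mulr_natr mulnn XE.
have E : M * d * (n ^ 2).+1%:R = e.
  have : (n ^ 2).+1%:R != 0 :> R by rewrite pnatr_eq0.
  by rewrite /d; move: _%:R => k k0; field; rewrite k0 gt_eqF.
have -> : M * h 0 v v * d * (n ^ 2)%:R = M * d * (n ^ 2)%:R * h 0 v v by ring.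
rewrite -E ler_wpM2r ?(ip_ge0 (ipW 0 W0)) //.
by rewrite ler_wpM2l ?ler_nat // ltW // mulr_gt0.
Unshelve. all: by end_near. Qed.

End Neighbourhoods.

Section ShortPaths.
Context {R : realType}.
Local Notation V := 'rV[R]_4.

Lemma planar_frame (P Q : V) : P != 0 ->
  exists e1 e2 : V, [/\ dot e1 e1 = 1, dot e2 e2 = 1 & dot e1 e2 = 0] /\
    P = enorm P *: e1 /\ exists q1 q2, 0 <= q2 /\ Q = q1 *: e1 + q2 *: e2.
Proof.
move=> P0; have p0 : 0 < enorm P by rewrite enorm_gt0.
pose e1 := (enorm P)^-1 *: P; pose q1 := dot Q e1; pose Y := Q - q1 *: e1.
have e11 : dot e1 e1 = 1.
  by rewrite dotZl dotZr -sqr_enorm; field; rewrite gt_eqF.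
have PE : P = enorm P *: e1 by rewrite scalerA divff ?scale1r // gt_eqF.
have Ye1 : dot e1 Y = 0.
  by rewrite /Y -scaleNr dotDr dotZr e11 dotC -/q1; ring.
have [Y0|Y0] := eqVneq Y 0.
  exists e1, (row4 (- e1 0 1) (e1 0 0) (- e1 0 3) (e1 0 2)); split; last first.
    split => //; exists q1, 0; split => //; rewrite scale0r addr0.
    by apply/eqP; rewrite -subr_eq0 -/Y Y0.
  split => //; first by rewrite -e11 /dot !sum4 !row4E; ring.
  by rewrite /dot sum4 !row4E; ring.
have y0 : 0 < enorm Y by rewrite enorm_gt0.
exists e1, ((enorm Y)^-1 *: Y); split; last first.
  split => //; exists q1, (enorm Y); split; first exact: ltW.
  by rewrite [X in _ + X]scalerA divff ?scale1r ?gt_eqF // /Y addrC subrK.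
split => //; last by rewrite dotZr Ye1 mulr0.
by rewrite dotZl dotZr -sqr_enorm; field; rewrite gt_eqF.
Qed.

Lemma trisection (t : R) : -1 <= t <= 1 ->
  exists2 a, 2^-1 <= a <= 1 & 4 * a ^+ 3 - 3 * a = t.
Proof.
move=> /andP[t1 t2].
pose p : {poly R} := 4%:P * 'X^3 - 3%:P * 'X - t%:P.
have pE x : p.[x] = 4 * x ^+ 3 - 3 * x - t.
  by rewrite /p !(hornerD, hornerN, hornerC, hornerM, hornerXn, hornerX).
have [||a a1 /rootP] := @poly_ivt R p 2^-1 1.
- by lra.
- have h : 2^-1 ^+ 3 = 8^-1 :> R by field.
  by rewrite !pE h expr1n; apply/andP; split; lra.
- rewrite pE => /eqP; rewrite subr_eq0 => /eqP E; exists a => //.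
Qed.

Lemma cube_root (x : R) : 0 <= x -> exists2 A, 0 <= A & x = A ^+ 3.
Proof.
move=> x0; exists (x `^ 3^-1); first exact: powR_ge0.
by rewrite -powR_mulrn ?powR_ge0 // -powRrM mulVf ?powRr1 // pnatr_eq0.
Qed.

(* In the plane of P and Q, identified with C, the cone metric 4 |w|^(-2/3)
   |dw|^2 becomes 36 |u|^2 |du|^2 for w = u^3.  Cube roots u1, u2 of P, Q chosen
   at an angle at most pi/3 are joined by a segment; its length is estimated by
   2 |u| <= M + |u|^2 / M. *)
Lemma short_path (P Q : V) (M : R) : P != 0 -> Q != 0 -> 0 < M ->
  enorm P <= M ^+ 3 -> enorm Q <= M ^+ 3 ->
  exists (w w' : R -> V) (S s : R -> R),
    [/\ w 0 = P, w 1 = Q & S 1 - S 0 <= 11 / 2 * M ^+ 2] /\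
    forall t : R, 0 <= t <= 1 ->
      [/\ is_derive t (1 : R) w (w' t), is_derive t (1 : R) S (s t),
          w t != 0 /\ dot (w t) (w t) <= M ^+ 6 & 0 <= s t /\
          4 * dot (w t) (w t) `^ (- 3^-1) * dot (w' t) (w' t) <= s t ^+ 2].
Proof.
move=> P0 Q0 M0 PM QM.
have [e1 [e2 [[e11 e22 e12] [PE [q1 [q2 [q20 QE]]]]]]] := planar_frame Q P0.
have p0 : 0 < enorm P by rewrite enorm_gt0.
have q0 : 0 < enorm Q by rewrite enorm_gt0.
have dotE (x1 y1 x2 y2 : R) :
    dot (x1 *: e1 + y1 *: e2) (x2 *: e1 + y2 *: e2) = x1 * x2 + y1 * y2.
  by rewrite !(dotDl, dotDr, dotZl, dotZr) (dotC e2) e11 e22 e12; ring.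
have qq : q1 ^+ 2 + q2 ^+ 2 = enorm Q ^+ 2 by rewrite sqr_enorm QE dotE.
have [a /andP[a1 a2] aE] : exists2 a, 2^-1 <= a <= 1 & 4 * a ^+ 3 - 3 * a = q1 / enorm Q.
  apply: trisection; rewrite -ler_norml -(ler_pXn2r (n := 2)) ?nnegrE // expr1n.
  rewrite normrM normfV (gtr0_norm q0) expr_div_n -qq real_normK ?num_real //.
  by rewrite ler_pdivrMr ?mul1r ?lerDl ?sqr_ge0 // qq exprn_gt0.
have [A A0 AE] := cube_root (ltW p0); have [B B0 BE] := cube_root (ltW q0).
have {}A0 : 0 < A by rewrite lt_neqAle A0 andbT eq_sym; apply: contraTneq p0 => A0';
  rewrite AE A0' expr0n ltxx.
have {}B0 : 0 < B by rewrite lt_neqAle B0 andbT eq_sym; apply: contraTneq q0 => B0';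
  rewrite BE B0' expr0n ltxx.
have AM : A <= M by rewrite -(ler_pXn2r (n := 3)) ?nnegrE ?(ltW A0) ?(ltW M0) // -AE.
have BM : B <= M by rewrite -(ler_pXn2r (n := 3)) ?nnegrE ?(ltW B0) ?(ltW M0) // -BE.
pose b := Num.sqrt (1 - a ^+ 2).
have b0 : 0 <= b by exact: sqrtr_ge0.
have bb : b ^+ 2 = 1 - a ^+ 2 by rewrite sqr_sqrtr //; nra.
have q1E : q1 = B ^+ 3 * (4 * a ^+ 3 - 3 * a).
  by rewrite aE -BE; field; rewrite gt_eqF.
have q2E : q2 = B ^+ 3 * (b * (4 * a ^+ 2 - 1)).
  apply/eqP; rewrite -(eqrXn2 (n := 2)) //; last first.
    by rewrite !mulr_ge0 ?exprn_ge0 ?(ltW B0) //; nra.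
  have -> : q2 ^+ 2 = (B ^+ 3) ^+ 2 - q1 ^+ 2 by rewrite -BE -qq; ring.
  by rewrite q1E; apply/eqP; rewrite !exprMn bb; ring.
pose al := B * a - A; pose be := B * b.
pose X t := A + t * al; pose Y t := t * be.
pose D := Num.sqrt (al ^+ 2 + be ^+ 2).
have D0 : 0 <= D by exact: sqrtr_ge0.
have DD : D ^+ 2 = al ^+ 2 + be ^+ 2 by rewrite sqr_sqrtr // addr_ge0 // sqr_ge0.
have DE : D ^+ 2 = A ^+ 2 + B ^+ 2 - 2 * A * B * a.
  by rewrite DD /al /be exprMn bb; ring.
have DM : D <= M.
  rewrite -(ler_pXn2r (n := 2)) ?nnegrE ?(ltW M0) // DE.
  have h1 : A * B <= 2 * A * B * a.
    have : 0 <= A * B * (2 * a - 1) by rewrite !mulr_ge0 ?(ltW A0) ?(ltW B0) //; lra.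
    by lra.
  have h2 : A ^+ 2 + B ^+ 2 - A * B <= M ^+ 2 by have [AB|AB] := leP A B; nra.
  by lra.
have UM t : 0 <= t <= 1 -> X t ^+ 2 + Y t ^+ 2 <= M ^+ 2.
  move=> /andP[t0 t1].
  have -> : X t ^+ 2 + Y t ^+ 2 =
      (1 - t) ^+ 2 * A ^+ 2 + t ^+ 2 * B ^+ 2 + 2 * (t * (1 - t)) * (A * B * a).
    by rewrite /X /Y /al /be !exprMn bb; ring.
  have h1 : A ^+ 2 <= M ^+ 2 by rewrite ler_pXn2r ?nnegrE ?(ltW A0) ?(ltW B0) ?(ltW M0).
  have h2 : B ^+ 2 <= M ^+ 2 by rewrite ler_pXn2r ?nnegrE ?(ltW A0) ?(ltW B0) ?(ltW M0).
  have h3 : A * B * a <= M ^+ 2.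
    apply: (@le_trans _ _ (A * B)); last by nra.
    by rewrite ler_piMr // mulr_ge0 ?(ltW A0) ?(ltW B0).
  have -> : M ^+ 2 = (1 - t) ^+ 2 * M ^+ 2 + t ^+ 2 * M ^+ 2 + 2 * (t * (1 - t)) * M ^+ 2.
    by ring.
  rewrite !lerD // ler_wpM2l ?sqr_ge0 // mulr_ge0 // mulr_ge0 // subr_ge0 //.
have X0 t : 0 <= t <= 1 -> 0 < X t.
  move=> /andP[t0 t1]; have Ba : 0 < B * a by nra.
  rewrite /X /al; have [->|tn] := eqVneq t 0; first by rewrite mul0r addr0.
  have tp : 0 < t by rewrite lt_neqAle eq_sym tn.
  have : 0 < t * (B * a) by rewrite mulr_gt0.
  have : 0 <= (1 - t) * A by rewrite mulr_ge0 ?(ltW A0) //; lra.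
  by lra.
pose w t := (X t ^+ 3 - 3 * X t * Y t ^+ 2) *: e1 + (3 * X t ^+ 2 * Y t - Y t ^+ 3) *: e2.
pose w' t := (3 * ((X t ^+ 2 - Y t ^+ 2) * al - 2 * X t * Y t * be)) *: e1
  + (3 * ((X t ^+ 2 - Y t ^+ 2) * be + 2 * X t * Y t * al)) *: e2.
pose S t := 3 * D * (M * t + (A ^+ 2 * t + A * al * t ^+ 2 + D ^+ 2 / 3 * t ^+ 3) / M).
pose s t := 3 * D * (M + (X t ^+ 2 + Y t ^+ 2) / M).
have wE t : dot (w t) (w t) = (X t ^+ 2 + Y t ^+ 2) ^+ 3 by rewrite dotE; ring.
have w'E t : dot (w' t) (w' t) = 9 * (X t ^+ 2 + Y t ^+ 2) ^+ 2 * D ^+ 2.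
  by rewrite dotE DD; ring.
pose pX := A%:P + 'X * al%:P; pose pY := 'X * be%:P.
have XE t : pX.[t] = X t by rewrite !(hornerD, hornerM, hornerC, hornerX).
have YE t : pY.[t] = Y t by rewrite !(hornerD, hornerM, hornerC, hornerX).
have pXD : pX^`() = al%:P by rewrite !(derivD, derivM, derivC, derivX) mulr0 addr0 mul1r add0r.
have pYD : pY^`() = be%:P by rewrite !(derivD, derivM, derivC, derivX) mulr0 addr0 mul1r.
clearbody pX pY.
exists w, w', S, s; split.
  split.
  - rewrite /w /X /Y !mul0r addr0 [in RHS]PE AE.
    by rewrite !expr0n /= !mulr0 !subr0 scale0r addr0.
  - rewrite [in RHS]QE q1E q2E /w /X /Y /al /be; congr (_ *: _ + _ *: _).
      by transitivity (B ^+ 3 * (a ^+ 3 - 3 * a * b ^+ 2)); [ring|rewrite bb; ring].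
    by transitivity (B ^+ 3 * (b * (3 * a ^+ 2 - b ^+ 2))); [ring|rewrite bb; ring].
  - have -> : S 1 - S 0 = 3 * D * (M + ((A ^+ 2 + B ^+ 2) / 2 - D ^+ 2 / 6) / M).
      have -> : B ^+ 2 = D ^+ 2 - A ^+ 2 + 2 * A * B * a by rewrite DE; ring.
      by rewrite /S /al; field; rewrite gt_eqF.
    apply: (@le_trans _ _ (3 * D * (M + (M ^+ 2 - D ^+ 2 / 6) / M))).
      rewrite ler_wpM2l ?mulr_ge0 // lerD2l ler_wpM2r ?invr_ge0 ?(ltW M0) // lerD2r.
      have h1 : A ^+ 2 <= M ^+ 2 by rewrite ler_pXn2r ?nnegrE ?(ltW A0) ?(ltW B0) ?(ltW M0).
      have h2 : B ^+ 2 <= M ^+ 2 by rewrite ler_pXn2r ?nnegrE ?(ltW A0) ?(ltW B0) ?(ltW M0).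
      by lra.
    have -> : 3 * D * (M + (M ^+ 2 - D ^+ 2 / 6) / M) =
        11 / 2 * M ^+ 2 - (M - D) * (11 * M ^+ 2 - M * D - D ^+ 2) / (2 * M).
      by field; rewrite gt_eqF.
    rewrite gerBl divr_ge0 ?mulr_ge0 ?subr_ge0 ?(ltW M0) //; nra.
move=> t t01; have Xt := X0 t t01; have Ut := UM t t01.
have U0 : 0 < X t ^+ 2 + Y t ^+ 2 by rewrite ltr_wpDr ?sqr_ge0 ?exprn_gt0.
split.
- have wP s' i : w s' 0 i = (((pX ^+ 3 - 3%:P * pX * pY ^+ 2) * (e1 0 i)%:P
      + (3%:P * pX ^+ 2 * pY - pY ^+ 3) * (e2 0 i)%:P).[s']).
    by rewrite !mxE !(hornerD, hornerN, hornerM, hornerC, horner_exp) !XE !YE.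
  have wD i : is_derive t (1 : R) (fun s' => w s' 0 i : R^o) (w' t 0 i).
    have -> : (fun s' => w s' 0 i) = horner ((pX ^+ 3 - 3%:P * pX * pY ^+ 2) * (e1 0 i)%:P
      + (3%:P * pX ^+ 2 * pY - pY ^+ 3) * (e2 0 i)%:P) by apply/funext => s'; exact: wP.
    apply: is_derive_eq.
    rewrite !(derivD, derivN, derivM, derivC, deriv_exp, pXD, pYD) /=.
    rewrite !(hornerD, hornerN, hornerM, hornerC, horner_exp, hornerMn) !XE !YE !mxE.
    by ring.
  have dw : derivable w t (1 : R).
    by apply/derivable_mxP => i j; rewrite (ord1 i); have := wD j; case.
  apply: DeriveDef => //; rewrite derive_mx //; apply/rowP => i; rewrite mxE.
  exact: (@derive_val _ _ _ _ _ _ _ (wD i)).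
- have -> : S = horner ((3 * D)%:P * (M%:P * 'X + ((A ^+ 2)%:P * 'X + (A * al)%:P * 'X^2
      + (D ^+ 2 / 3)%:P * 'X^3) * (M^-1)%:P)).
    by apply/funext => s'; rewrite !(hornerD, hornerM, hornerC, hornerX, hornerXn).
  apply: is_derive_eq.
  rewrite !(derivD, derivM, derivC, derivXn, derivX) /=.
  rewrite !(hornerD, hornerM, hornerC, hornerX, hornerXn, hornerMn) /s.
  have -> : X t ^+ 2 + Y t ^+ 2 = A ^+ 2 + 2 * A * al * t + D ^+ 2 * t ^+ 2.
    by rewrite DD /X /Y; ring.
  by field; rewrite gt_eqF.
- split; first by rewrite -dot_gt0 wE exprn_gt0.
  rewrite wE (_ : M ^+ 6 = (M ^+ 2) ^+ 3); last by rewrite -exprM.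
  by rewrite ler_pXn2r ?nnegrE ?sqr_ge0 ?(ltW U0).
- split; first by rewrite /s !mulr_ge0 // addr_ge0 ?divr_ge0 ?(ltW U0) ?(ltW M0).
  rewrite wE w'E /s; move: (X t ^+ 2 + Y t ^+ 2) U0 => q q_gt0.
  have -> : (q ^+ 3) `^ (- 3^-1) = q^-1.
    rewrite -powR_mulrn ?(ltW q_gt0) // -powRrM -(powR_inv1 (ltW q_gt0)).
    by congr (_ `^ _); field.
  rewrite -subr_ge0.
  have -> : (3 * D * (M + q / M)) ^+ 2 - 4 * q^-1 * (9 * q ^+ 2 * D ^+ 2) =
      (3 * D * (M - q / M)) ^+ 2 by field; rewrite !gt_eqF.
  exact: sqr_ge0.
Qed.

End ShortPaths.

Section ChainRules.
Context {R : realType}.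

Lemma derive_comp (V W Z : normedModType R) (f : V -> W) (g : W -> Z) x v :
  differentiable f x -> differentiable g (f x) ->
  'D_v (g \o f) x = 'D_('D_v f x) g (f x).
Proof.
move=> df dg; have dgf := differentiable_comp df dg.
by rewrite !deriveE // (diff_comp df dg).
Qed.

Lemma is_derive_curve (V W : normedModType R) (w : R -> V) (f : V -> W) (t : R) w' :
  is_derive t (1 : R) w w' -> differentiable f (w t) ->
  is_derive t (1 : R) (f \o w) ('D_w' f (w t)).
Proof.
move=> [dw wE] df; have dw1 : differentiable w t by exact/derivable1_diffP.
apply: DeriveDef; first by apply/derivable1_diffP; exact: differentiable_comp.
by rewrite derive_comp // wE.
Qed.

Lemma is_derive_scale (V : normedModType R) (t : R) (y : V) :
  is_derive t (1 : R) (fun s : R => s *: y) y.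
Proof.
have d := is_diff_scalel t y; apply: DeriveDef.
  by apply/derivable1_diffP; exact: (@ex_diff _ _ _ _ _ _ _ d).
rewrite deriveE; last exact: (@ex_diff _ _ _ _ _ _ _ d).
by rewrite (@diff_val _ _ _ _ _ _ _ d) scale1r.
Qed.

Lemma linear_functional_derive n (L : 'rV[R]_n -> R^o) (x v : 'rV[R]_n) :
  (forall s u w, L (s *: u + w) = s * L u + L w) ->
  differentiable L x /\ 'D_v L x = L v.
Proof.
move=> LL.
have L0 : L 0 = 0.
  by have := LL (-1) 0 0; rewrite scaler0 addr0 mulN1r addNr.
have Lsum (r : seq 'I_n) (c : 'I_n -> R) :
    L (\sum_(i <- r) c i *: basis i) = \sum_(i <- r) c i * L (basis i).
  by elim: r => [|i r IH]; rewrite ?big_nil // !big_cons LL IH.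
have LE : L = \sum_i (fun y : 'rV[R]_n => L (basis i) *: (y 0 i : R^o)).
  apply/funext => y; rewrite fct_sumE {1}[y]row_sum_delta Lsum.
  by apply: eq_bigr => i _; rewrite mulrC.
have dc i y : differentiable (fun y : 'rV[R]_n => L (basis i) *: (y 0 i : R^o)) y.
  by apply: differentiableZ; exact: differentiable_coord.
have dL y : differentiable L y by rewrite LE; exact: differentiable_sum.
split => //; rewrite LE derive_sum => [|i]; last exact/diff_derivable.
rewrite -LE [in RHS](row_sum_delta v) Lsum; apply: eq_bigr => i _.
rewrite deriveZ ?coord_derive 1?mulrC //.
by apply/diff_derivable; exact: differentiable_coord.
Qed.

End ChainRules.

Section NotSmooth.
Context {R : realType}.
Local Notation V4 := 'rV[R]_4.

Lemma derivable_monotone (f df : R -> R) (a b : R) : a <= b ->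
  (forall t, a <= t <= b -> is_derive t (1 : R) f (df t) /\ 0 <= df t) -> f a <= f b.
Proof.
move=> ab H.
have D t : a <= t <= b -> derivable f t 1 by move=> /H[[]].
have [||c] := @MVT_segment R f df a b ab.
- by move=> t; rewrite in_itv /= => /andP[/ltW at_ /ltW tb]; apply: (H t _).1; rewrite at_.
- by apply: derivable_within_continuous => t; rewrite in_itv /=; exact: D.
rewrite in_itv /= => /H[_ dc] E.
by rewrite -subr_ge0 E mulr_ge0 // subr_ge0.
Qed.

Lemma derive_dot_powR_chain (F : V4 -> V4) (z u : V4) (a : R) :
  differentiable F z -> F z != 0 ->
  differentiable (fun y => dot (F y) (F y) `^ a : R^o) z /\
  'D_u (fun y => dot (F y) (F y) `^ a : R^o) z =
    a * dot (F z) (F z) `^ (a - 1) * (2 * dot (F z) ('D_u F z)).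
Proof.
move=> dF F0; have [d D] := dot_powR_derive a ('D_u F z) F0.
by split; [exact: (differentiable_comp dF d)|rewrite -D -(derive_comp u dF d)].
Qed.

Section Chart.
Context (p : V4) (V W : set V4) (Phi Phi' : V4 -> V4) (h : @metric R 4).
Context (oV : open V) (V0 : V 0) (oW : open W) (W0 : W 0).
Context (dPhi : diffeo (V `\ 0) (W `\ 0) Phi Phi').
Context (Phi0 : Phi 0 = 0) (cPhi : {for 0, continuous Phi}).
Context (Phi'0 : Phi' 0 = 0) (cPhi' : {for 0, continuous Phi'}).
Context (hW : riemannian W h).
Context (hE : forall x u v, V x -> x != 0 ->
  pullback_metric Phi h x u v = fibre_metric 0 p x u v).

Let ip0 : inner_product (h 0).
Proof. by case: hW => C L P _; split => [u v|s u v w|u u0]; [exact: C|exact: L|exact: P]. Qed.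

Lemma open_punctured (U : set V4) : open U -> open (U `\ 0).
Proof. by move=> oU; rewrite setDE; apply: openI => //; exact: open_neq0. Qed.

Lemma chart_inverse_metric (y u : V4) : W y -> y != 0 ->
  4 * dot (Phi' y) (Phi' y) `^ (- 3^-1) * dot ('D_u Phi' y) ('D_u Phi' y) = h y u u.
Proof.
case: dPhi => VW WV sPhi sPhi' Wy y0.
have Wy0 : (W `\ 0) y by split => //; exact/eqP.
have [Vx0 PhiK] := WV y Wy0; have [Vx x0'] := Vx0.
have x0 : Phi' y != 0 by exact/eqP.
have d' : differentiable Phi' y := sPhi' [::] y Wy0.
have d : differentiable Phi (Phi' y) := sPhi [::] _ Vx0.
have := hE ('D_u Phi' y) ('D_u Phi' y) Vx x0.
rewrite fibre_metricE add0r /= => <-; rewrite /pullback_metric PhiK -derive_comp //.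
rewrite (@open_eq_derive _ _ _ (W `\ 0) (Phi \o Phi') id) //; last first.
- by move=> z /WV[].
- exact: open_punctured.
by rewrite derive_id.
Qed.

Section RadialBound.
Context (e r : R) (cmp : forall y, dot y y < r ->
  W y /\ forall v, `|h y v v - h 0 v v| <= e * h 0 v v).

(* R = 3 |x|^(2/3) is 1-Lipschitz for the cone metric and vanishes at the origin. *)
Lemma chart_radial_bound (y : V4) (M : R) : y != 0 -> dot y y < r -> 0 < M ->
  (1 + e) * h 0 y y <= 9 * M ^+ 4 -> enorm (Phi' y) <= M ^+ 3.
Proof.
case: dPhi => VW WV sPhi sPhi' y0 yr M0 hM.
have N0 : 0 < dot y y by rewrite dot_gt0.
pose F z := dot (Phi' z) (Phi' z) `^ 3^-1.
suff FM : F y <= M ^+ 2.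
  have FE : F y ^+ 3 = enorm (Phi' y) ^+ 2.
    rewrite /F -powR_mulrn ?powR_ge0 // -powRrM mulVf ?pnatr_eq0 //.
    by rewrite powRr1 ?dot_ge0 // sqr_enorm.
  rewrite -(ler_pXn2r (n := 2)) ?nnegrE ?enorm_ge0 ?exprn_ge0 ?(ltW M0) // -FE.
  by rewrite -exprM (exprM _ 2 3) ler_pXn2r ?nnegrE ?powR_ge0 ?sqr_ge0.
apply/ler_addgt0Pr => d d0.
have [d2 d20 Hd2] : exists2 d2, 0 < d2 & forall z, dot z z < d2 -> dot (Phi' z) (Phi' z) < d ^+ 3.
  apply: nbhs0_dot; have : Phi' z @[z --> (0 : V4)] --> Phi' 0 by exact: cPhi'.
  by rewrite Phi'0 => /(_ _ (near0_dot (exprn_gt0 3 d0))).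
pose eta := d2 / (d2 + dot y y).
have dN : 0 < d2 + dot y y by exact: addr_gt0.
have eta0 : 0 < eta by exact: divr_gt0.
have eta1 : eta < 1 by rewrite ltr_pdivrMr // mul1r ltrDl.
have Feta : F (eta *: y) <= d.
  have := Hd2 (eta *: y); rewrite dotZl dotZr => /(_ _)/ltW H.
  have {H} : dot (Phi' (eta *: y)) (Phi' (eta *: y)) <= d ^+ 3.
    apply: H; apply: (@le_lt_trans _ _ (eta * dot y y)).
      by rewrite ler_wpM2l ?(ltW eta0) // ler_piMl ?(ltW N0) ?(ltW eta1).
    rewrite /eta mulrAC ltr_pdivrMr // ltr_pM2l // ltrDr //.
  rewrite /F => H; apply: le_trans (_ : (d ^+ 3) `^ 3^-1 <= d).
    by apply: ge0_ler_powR; rewrite ?nnegrE ?dot_ge0 ?exprn_ge0 ?(ltW d0).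
  by rewrite -powR_mulrn ?(ltW d0) // -powRrM mulfV ?pnatr_eq0 // powRr1 ?(ltW d0).
pose f (t : R) : R^o := M ^+ 2 * t - F (t *: y).
suff : f eta <= f 1.
  rewrite /f scale1r mulr1 lerBrDr addrAC -lerBrDr => /le_trans.
  have Me : 0 <= M ^+ 2 * eta by rewrite mulr_ge0 ?sqr_ge0 ?(ltW eta0).
  move=> H; have := H _ (lexx _).
  by lra.
apply: (@derivable_monotone f (fun t => M ^+ 2 - 'D_y F (t *: y))); first exact: ltW.
move=> t /andP[et t1].
have t0 : 0 < t by exact: lt_le_trans et.
have ty0 : t *: y != 0 by rewrite scaler_eq0 negb_or gt_eqF.
have tyr : dot (t *: y) (t *: y) < r.
  apply: le_lt_trans yr; rewrite dotZl dotZr mulrA ler_piMl ?(ltW N0) //.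
  by rewrite mulr_ile1 ?(ltW t0).
have [Wty Hty] := cmp tyr.
have Wty0 : (W `\ 0) (t *: y) by split => //; exact/eqP.
have dF' : differentiable Phi' (t *: y) := sPhi' [::] _ Wty0.
have [[_ x0'] _] := WV _ Wty0.
have x0 : Phi' (t *: y) != 0 by exact/eqP.
have [dF DF] := derive_dot_powR_chain y 3^-1 dF' x0.
split.
  have H1 := is_derive_curve (is_derive_scale t y) dF.
  have H2 : is_derive t (1 : R) (fun s : R => s *: (M ^+ 2 : R^o)) (M ^+ 2 : R^o).
    exact: is_derive_scale.
  have -> : f = (fun s : R => s *: (M ^+ 2 : R^o)) \- (F \o (fun s : R => s *: y)).
    by apply/funext => s; rewrite /f /= mulrC.
  exact: is_deriveB.
rewrite subr_ge0 DF; set x := Phi' _ in x0 *; set xi := 'D_y Phi' _.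
have xx : 0 < dot x x by rewrite dot_gt0.
apply: le_trans (ler_norm _) _.
rewrite -(ler_pXn2r (n := 2)) ?nnegrE ?sqr_ge0 // real_normK ?num_real //.
apply: (@le_trans _ _ (9^-1 * (4 * dot x x `^ (- 3^-1) * dot xi xi))); last first.
  rewrite (chart_inverse_metric y Wty ty0) -exprM.
  have := Hty y; rewrite ler_distl => /andP[_ H].
  rewrite ler_pdivrMl //; apply: le_trans hM; apply: le_trans H _.
  by rewrite mulrDl mul1r.
have -> : dot x x `^ (3^-1 - 1) = dot x x `^ (- 3^-1) * dot x x `^ (- 3^-1).
  rewrite -powRD ?implybE ?(gt_eqF xx) ?orbT //; congr (_ `^ _); by field.
have E : dot x x `^ (- 3^-1) * dot x x `^ (- 3^-1) * dot x x `^ (- 3^-1) * dot x x = 1.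
  rewrite -{4}(powRr1 (ltW xx)) -!powRD ?implybE ?(gt_eqF xx) ?orbT //.
  by rewrite (_ : _ + 1 = 0) ?powRr0 //; field.
set q := dot x x `^ _ in E *.
have q0 : 0 <= q by exact: powR_ge0.
have -> : (3^-1 * (q * q) * (2 * dot x xi)) ^+ 2 =
  9^-1 * (4 * q * (q ^+ 3 * dot x xi ^+ 2)) by field.
rewrite ler_wpM2l ?invr_ge0 // ler_wpM2l ?mulr_ge0 //.
apply: (@le_trans _ _ (q ^+ 3 * (dot x x * dot xi xi))).
  by rewrite ler_wpM2l ?exprn_ge0 // dot_CS.
by rewrite mulrA -[leRHS]mul1r -E ler_wpM2r ?dot_ge0 // le_eqVlt; apply/orP; left;
  apply/eqP; ring.
Qed.

End RadialBound.

(* The points Phi'(y), Phi'(-y) of the cone are joined by a path of length at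
   most (11/6) |y|, up to the distortion of h near 0, which is at most 1/20; but
   the image of this path goes from y to -y. *)
Lemma chart_absurd : False.
Proof.
case: (dPhi) => VW WV sPhi sPhi'.
have e_gt0 : 0 < 20^-1 :> R by [].
have e_le1 : 20^-1 <= 1 :> R by rewrite invf_le1 // ler1n.
have nW : \forall y \near (0 : V4), W y by exact: open_nbhs_nbhs.
have [r r0 cmp] := nbhs0_dot (filterI nW (near_metric_comparison oW W0 hW e_gt0)).
have nV : \forall x \near (0 : V4), V x by exact: open_nbhs_nbhs.
have nPhi : \forall x \near (0 : V4), dot (Phi x) (Phi x) < r.
  have : Phi z @[z --> (0 : V4)] --> Phi 0 by exact: cPhi.
  by rewrite Phi0 => /(_ _ (near0_dot r0)).
have [d d0 dP] := nbhs0_dot (filterI nV nPhi).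
pose u : V4 := basis 0.
have uu : dot u u = 1 by rewrite dot_basisl mxE !eqxx.
have u0 : u != 0 by rewrite -dot_gt0 uu.
have N0 : 0 < h 0 u u by exact: ip_pos ip0 _ u0.
pose k := 9 / ((1 + 20^-1) * h 0 u u).
have k0 : 0 < k by rewrite divr_gt0 // mulr_gt0 // addr_gt0.
have [M [M0 M1 Mr Md]] : exists M : R, [/\ 0 < M, M <= 1, k * M < r & M < d].
  exists (Num.min 1 (Num.min (r / (2 * k)) (d / 2))).
  have rk : 0 < r / (2 * k) by rewrite divr_gt0 // mulr_gt0.
  have d20 : 0 < d / 2 by rewrite divr_gt0.
  rewrite !lt_min ge_min lexx rk d20 ltr01 /=; split => //.
    have rk2 : r / (2 * k) < k^-1 * r.
      have -> : r / (2 * k) = k^-1 * r / 2 by field; rewrite gt_eqF.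
      by rewrite ltr_pdivrMr // ltr_pMr ?ltr1n // mulr_gt0 // invr_gt0.
    by rewrite -ltr_pdivlMl // !gt_min rk2 orbT.
  have d2 : d / 2 < d by rewrite ltr_pdivrMr // ltr_pMr // ltr1n.
  by rewrite !gt_min d2 !orbT.
have M4 : M ^+ 4 <= M by rewrite -[leRHS]expr1 ler_wiXn2l // ltW.
have M6 : M ^+ 6 <= M by rewrite -[leRHS]expr1 ler_wiXn2l // ltW.
pose y := (Num.sqrt k * M ^+ 2) *: u.
have kk : Num.sqrt k ^+ 2 = k by rewrite sqr_sqrtr // ltW.
have sk : 0 < Num.sqrt k by rewrite sqrtr_gt0.
have y0 : y != 0 by rewrite scaler_eq0 negb_or u0 andbT gt_eqF // mulr_gt0 ?exprn_gt0.
have yy : dot y y = k * M ^+ 4.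
  by rewrite dotZl dotZr uu mulr1 -[in RHS]kk; ring.
have yr : dot y y < r by rewrite yy (le_lt_trans _ Mr) // ler_wpM2l // ltW.
have hy : (1 + 20^-1) * h 0 y y = 9 * M ^+ 4.
  rewrite /y (ipZl ip0) (ipZr ip0).
  transitivity ((1 + 20^-1) * (Num.sqrt k ^+ 2 * M ^+ 4 * h 0 u u)); first by ring.
  by rewrite kk /k; field; rewrite gt_eqF.
have Ny0 : - y != 0 by rewrite oppr_eq0.
have Nyr : dot (- y) (- y) < r by rewrite dotNl dotC dotNl opprK.
have hNy : h 0 (- y) (- y) = h 0 y y.
  by rewrite -scaleN1r (ipZl ip0) (ipZr ip0); ring.

have PM : enorm (Phi' y) <= M ^+ 3.
  by apply: (chart_radial_bound cmp y0 yr M0); rewrite hy.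
have QM : enorm (Phi' (- y)) <= M ^+ 3.
  by apply: (chart_radial_bound cmp Ny0 Nyr M0); rewrite hNy hy.
have Wy : (W `\ 0) y by split; [exact: (cmp y yr).1|exact/eqP].
have WNy : (W `\ 0) (- y) by split; [exact: (cmp _ Nyr).1|exact/eqP].
have [[_ P0] PhiP] := WV _ Wy; have [[_ Q0] PhiQ] := WV _ WNy.
have {}P0 : Phi' y != 0 by exact/eqP.
have {}Q0 : Phi' (- y) != 0 by exact/eqP.
have [w [w' [S [s [[w0 w1 SM] path]]]]] := short_path P0 Q0 M0 PM QM.
set N := h 0 y y in hy hNy.
have Npos : 0 < N by exact: ip_pos ip0 _ y0.
pose K := Num.sqrt (N / (1 - 20^-1)).
have c0 : 0 < 1 - 20^-1 :> R by lra.
have K0 : 0 <= K by exact: sqrtr_ge0.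
have KK : K ^+ 2 = N / (1 - 20^-1) by rewrite sqr_sqrtr // divr_ge0 ?(ltW c0) ?(ltW Npos).
have LL a v1 v2 : h 0 (a *: v1 + v2) y = a * h 0 v1 y + h 0 v2 y.
  by rewrite (ipDl ip0) (ipZl ip0).
pose f (t : R) : R^o := K * S t + h 0 (Phi (w t)) y.
have : f 0 <= f 1.
  apply: (@derivable_monotone f (fun t => K * s t + h 0 ('D_(w' t) Phi (w t)) y)) => // t t01.
  have [dw dS [wt0 wtM] [st0 st]] := path t t01.
  have [Vw Phir] := dP (w t) (le_lt_trans wtM (le_lt_trans M6 Md)).
  have Vw0 : (V `\ 0) (w t) by split => //; exact/eqP.
  have dPw : differentiable Phi (w t) := sPhi [::] _ Vw0.
  have [dL DL] := linear_functional_derive (L := fun v => h 0 v y)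
    (Phi (w t)) ('D_(w' t) Phi (w t)) LL.
  split.
    have -> : f = (K \*: (S : R -> R^o)) \+ ((fun v => h 0 v y : R^o) \o (Phi \o w)) by [].
    apply: is_deriveD; rewrite -DL; apply: is_derive_curve => //.
    exact: is_derive_curve.
  set xi := 'D_(w' t) Phi (w t).
  have [_ /(_ xi)] := cmp _ Phir; rewrite ler_distl => /andP[hxi _].
  have gE : h (Phi (w t)) xi xi = 4 * dot (w t) (w t) `^ (- 3^-1) * dot (w' t) (w' t).
    by have := hE (w' t) (w' t) Vw wt0; rewrite fibre_metricE add0r.
  have hs : h 0 xi xi <= s t ^+ 2 / (1 - 20^-1).
    rewrite ler_pdivlMr // mulrBr mulr1 mulrC; apply: le_trans hxi _.
    by rewrite gE.
  have CS : h 0 xi y ^+ 2 <= (K * s t) ^+ 2.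
    have -> : (K * s t) ^+ 2 = s t ^+ 2 / (1 - 20^-1) * N.
      by rewrite exprMn KK mulrC mulrA mulrAC.
    by apply: le_trans (ip_CS ip0 _ _) _; rewrite ler_wpM2r // ltW.
  have : `|h 0 xi y| <= K * s t.
    by rewrite -(ler_pXn2r (n := 2)) ?nnegrE ?mulr_ge0 // real_normK ?num_real.
  by rewrite ler_norml => /andP[H _]; rewrite -lerBlDl sub0r.
rewrite /f w0 w1 PhiP PhiQ -/N.
have -> : h 0 (- y) y = - N by rewrite -scaleN1r (ipZl ip0) mulN1r.
move=> H.
have H1 : 2 * N <= K * (11 / 2 * M ^+ 2).
  apply: (@le_trans _ _ (K * (S 1 - S 0))); last by rewrite ler_wpM2l.
  by lra.
have H2 : (2 * N) ^+ 2 <= (K * (11 / 2 * M ^+ 2)) ^+ 2.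
  by rewrite ler_pXn2r ?nnegrE ?mulr_ge0 ?invr_ge0 ?(ltW Npos) ?(ltW M0).
have M4E : M ^+ 4 = (1 + 20^-1) * N / 9 by rewrite hy; field.
have : 4 * N ^+ 2 <= N / (1 - 20^-1) * (121 / 4 * ((1 + 20^-1) * N / 9)).
  rewrite -M4E -KK; apply: le_trans (_ : _ <= (2 * N) ^+ 2) (le_trans H2 _).
    by rewrite exprMn; lra.
  by rewrite le_eqVlt; apply/orP; left; apply/eqP; field.
have -> : N / (1 - 20^-1) * (121 / 4 * ((1 + 20^-1) * N / 9)) = 2541 / 684 * N ^+ 2 by field.
by rewrite ler_pM2r ?exprn_gt0 //; lra.
Qed.

End Chart.

Lemma fibre_metric_not_smooth (p : V4) : ~ smooth_at_origin (fibre_metric 0 p).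
Proof.
case=> V [W [Phi [Phi' [h [[oV V0 oW W0] [[dPhi Phi0 cPhi Phi'0 cPhi'] [hW hE]]]]]]].
exact: (chart_absurd oV V0 oW W0 dPhi Phi0 cPhi Phi'0 cPhi' hW hE).
Qed.

End NotSmooth.

Theorem proposition4p4 (R : realType) :
  let link_metric : @metric R 4 := fun x u v => 4 / 9 * round_metric x u v in
  (* (a) *)
  (forall (c : R) (p : 'rV[R]_4), 0 < c -> sphere p ->
    [/\ coassociative c setT (fibre_map p),
        riemannian setT (fibre_metric c p),
        conformally_flat setT (fibre_metric c p) &
        asymptotically_conical setT (fibre_metric c p) (- 3) link_metric]) /\
  (* (b) *)
  (forall p : 'rV[R]_4, sphere p ->
    [/\ coassociative 0 (~` [set 0]) (fibre_map p),
        riemannian (~` [set 0]) (fibre_metric 0 p) &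
        isometric (@cone R 4 0) (cone_chart_metric link_metric)
                  (~` [set 0]) (fibre_metric 0 p)] /\
    [/\ conformally_flat (~` [set 0]) (fibre_metric 0 p),
        ~ flat (~` [set 0]) (fibre_metric 0 p) &
        ~ smooth_at_origin (fibre_metric 0 p)]) /\
  (* the induced triples *)
  hyperkahler setT (@standard_triple R) /\
  (forall c : R, 0 <= c ->
    (exists n, dual_normal_fields c n) /\
    (forall n, dual_normal_fields c n ->
      exists k : R, 0 < k /\
        forall p : 'rV[R]_4, sphere p ->
          hypersymplectic (fibre c) (induced_triple c n p) /\
          forall i x v, fibre c x ->
            induced_triple c n p i x v = k * standard_triple i x v)).
Proof.
have fT (c : R) : 0 < c -> fibre c = setT :> set 'rV[R]_4.
  by move=> c0; rewrite /fibre gt_eqF.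
have f0 : fibre 0 = ~` [set 0] :> set 'rV[R]_4 by rewrite /fibre eqxx.
move=> link_metric; split => [c p c0 _|].
  split; first exact: fibre_coassociative.
  - by rewrite -(fT c c0); exact/fibre_metric_riemannian/ltW.
  - by rewrite -(fT c c0); exact/fibre_metric_conformally_flat/ltW.
  - exact: fibre_metric_asymptotics.
split => [p _|].
  split; split.
  - exact: fibre_coassociative.
  - by rewrite -f0; exact: fibre_metric_riemannian.
  - exact: cone_fibre_isometric.
  - by rewrite -f0; exact: fibre_metric_conformally_flat.
  - exact: fibre_metric_not_flat.
  - exact: fibre_metric_not_smooth.
split; first exact: standard_hyperkahler.
by move=> c _; exact: induced_triples.
Qed.
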